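(* Let $G=(V,E,\omega)$ be an infinite weighted graph as in the context, and let $p>1$, $q>0$. Assume that $G$ satisfies the $d$-isoperimetric inequality for some $d>p>1$ and that $q(p-1)<\frac{d-p}{d}$. Set $m=\frac{d(1-q(p-1))}{p}>1$. Let $r\ge1$ and let $u\in L^\infty([0,+\infty);\ell^r(V))$ be a solution of $$\begin{cases}\partial_t u(x,t)=\Delta_p u^q(x,t), & x\in V,\ t>0,\\ u(x,0)=u_0(x), & x\in V,\end{cases}$$ with $u_0\in\ell^m(V)$. If $q>1$, then there exists a constant $C(p,q,d)>0$ such that $$u(\cdot,t)\equiv0\quad\text{for all } t\ge C(p,q,d)\,\|u_0\|_{\ell^m(V)}^{mp/d}.$$ Furthermore, if $u$ is an exhaustion solution, then this finite-time extinction result holds for the full range $q>0$.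
   Context: Graph: $G=(V,E,\omega)$ is an infinite, connected, countable weighted graph with no multiple edges or self-loops; $\omega:V\times V\to[0,\infty)$ is symmetric and $\omega_{xy}=\omega(x,y)>0$ if and only if $\{x,y\}\in E$ (written $x\sim y$). Every vertex has finite degree, $\mu(x)=\sum_{y\sim x}\omega_{xy}$, and $\mu_0:=\inf_{x\in V}\mu(x)>0$. $\mu_V(U)=\sum_{x\in U}\mu(x)$ for $U\subset V$, and $\mu_E(K)=\sum_{\{x,y\}\in K}\omega_{xy}$ for $K\subset E$. $d(x,y)$ is the graph distance and $B_R(x_0)=\{x\in V:d(x,x_0)\le R\}$. Isoperimetric inequality: for $\Omega\subset V$ let $\partial\Omega=\{\{x,y\}\in E:x\in\Omega,\ y\in V\setminus\Omega\}$. $G$ satisfies the $d$-isoperimetric inequality ($d>1$) if there is a finite constant $C_d$ such that $\mu_V(\Omega)^{\frac{d-1}{d}}\le C_d\,\mu_E(\partial\Omega)$ for all finite $\Omega\subset V$. The graph $G$, and hence its isoperimetric constant $C_d$, is fixed; the constant $C(p,q,d)$ may depend on $C_d$ but not on $u$ or $u_0$. Norms: $\|f\|_{\ell^r(V)}=\big(\sum_{x\in V}|f(x)|^r\mu(x)\big)^{1/r}$ for $r\ge1$. Powers: for $k\in\mathbb R$, $s>0$, $k^s:=|k|^{s-1}k$ (so $0^s=0$). Operator: $\Delta_p u^q(x,t)=\frac1{\mu(x)}\sum_{y\in V}|u^q(y,t)-u^q(x,t)|^{p-2}(u^q(y,t)-u^q(x,t))\,\omega_{xy}$. Solution: a solution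 in $L^\infty([0,T);\ell^r(V))$ ($0<T\le+\infty$, $r\ge1$) is a function $u:V\times[0,T)\to\mathbb R$ with $u\in L^\infty([0,T);\ell^r(V))$, $u(x,\cdot)\in C^1([0,T))$ for all $x\in V$, satisfying the initial value problem pointwise. Exhaustion solution: fix $x_0\in V$. For $n\ge1$ consider the mixed problem $$\begin{cases}\partial_t u_n(x,t)=\Delta_p u_n^q(x,t), & x\in B_n(x_0),\ t>0,\\ u_n(x,0)=u_0(x), & x\in B_n(x_0),\\ u_n(x,t)=0,& x\notin B_n(x_0),\ t\ge0.\end{cases}$$ A solution $u\in L^\infty([0,+\infty);\ell^r(V))$ of the initial value problem is an exhaustion solution if there is a subsequence $n_k\to\infty$ with $u(x,t)=\lim_{k\to\infty}u_{n_k}(x,t)$ for all $(x,t)\in V\times[0,+\infty)$, where each $u_{n_k}$ is a solution of the mixed problem on $B_{n_k}(x_0)$. *)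

(* Defs.v *)
From HB Require Import structures.
From mathcomp Require Import all_boot all_order all_algebra.
From mathcomp Require Import all_classical all_reals all_analysis.

Set Implicit Arguments.
Unset Strict Implicit.
Unset Printing Implicit Defensive.

Import Order.TTheory GRing.Theory Num.Theory.
Import numFieldNormedType.Exports.

Local Open Scope classical_set_scope.
Local Open Scope ring_scope.

Section weights.
Context {R : realType} {V : countType}.
Variable w : V -> V -> R.

Definition adjacent : rel V := fun x y => 0 < w x y.

(* Finite-support sum: meaningful when [x] has finitely many neighbours. *)
Definition wdegree (x : V) : R := \sum_(y \in [set y | adjacent x y]) w x y.

Definition is_walk (x y : V) (s : seq V) : Prop :=
  path adjacent x s /\ last x s = y.

End weights.

Record wgraph (R : realType) (V : countType) := WGraph {
  weight :> V -> V -> R ;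
  weight_ge0 : forall x y, 0 <= weight x y ;
  weight_sym : forall x y, weight x y = weight y x ;
  weight_irrefl : forall x, weight x x = 0 ;
  wgraph_infinite : infinite_set [set: V] ;
  wgraph_connected : forall x y, exists s, is_walk weight x y s ;
  wgraph_locally_finite : forall x, finite_set [set y | adjacent weight x y] ;
  wgraph_inf_degree_gt0 : 0 < inf (range (wdegree weight))
}.

Section graph_notions.
Context {R : realType} {V : countType}.
Variable G : wgraph R V.

Definition gdist (x y : V) : R :=
  inf [set (size s)%:R | s in [set s | is_walk G x y s]].

Definition gball (x0 : V) (n : nat) : set V := [set x | gdist x x0 <= n%:R].

Definition mu_V (U : set V) : R := \sum_(x \in U) wdegree G x.

(* A set of edges is given as a set of ordered pairs containing exactly one
   orientation of each edge. *)
Definition mu_E (K : set (V * V)) : R := \sum_(e \in K) G e.1 e.2.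

(* Each boundary edge has exactly one endpoint in [W]; it is oriented from
   that endpoint outwards, so it is counted once. *)
Definition edge_boundary (W : set V) : set (V * V) :=
  [set e | [/\ adjacent G e.1 e.2, W e.1 & ~ W e.2]].

Definition isoperimetric (d Cd : R) : Prop :=
  forall W : set V, finite_set W ->
    mu_V W `^ ((d - 1) / d) <= Cd * mu_E (edge_boundary W).

(* Extended-real valued; finite exactly on l^r(V). *)
Definition lnorm (r : R) (f : V -> R) : \bar R :=
  ((\esum_(x in [set: V]) (`|f x| `^ r * wdegree G x)%:E) `^ (r^-1))%E.

Definition in_lr (r : R) (f : V -> R) : Prop := (lnorm r f < +oo)%E.

(* L^oo([0, +oo); l^r(V)).  As V is countable and r < +oo, l^r(V) is separable,
   so by Pettis strong measurability is measurability of each coordinate. *)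
Definition Linfty_lr (r : R) (u : V -> R -> R) : Prop :=
  (forall x, measurable_fun (`[0, +oo[%classic : set R) (u x)) /\
  exists M : R, {ae (@lebesgue_measure R), forall t : R,
    0 <= t -> (lnorm r (fun x => u x t) <= M%:E)%E}.

(* |k|^(s-1) k; it vanishes at k = 0 for every s. *)
Definition spow (k s : R) : R := `|k| `^ (s - 1) * k.

(* Delta_p applied to v; the summand at y is 0 unless y is adjacent to x, and
   |a|^(p-2) a is read as 0 at a = 0, also for p < 2. *)
Definition plaplacian (p : R) (v : V -> R) (x : V) : R :=
  (wdegree G x)^-1 *
  \sum_(y \in [set: V]) (`|v y - v x| `^ (p - 2) * (v y - v x) * G x y).

(* C^1 on [0, +oo): the derivative at 0 is one-sided. *)
Definition C1_halfline (f : R -> R) : Prop :=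
  exists g : R -> R,
    (forall t : R, 0 <= t ->
      (fun s : R => (f s - f t) / (s - t))
        @ within [set s : R | 0 <= s /\ s != t] (nbhs t) --> g t) /\
    {within `[0, +oo[, continuous g}.

Definition evolves_at (p q : R) (u : V -> R -> R) (x : V) : Prop :=
  forall t : R, 0 < t ->
    derive1 (u x) t = plaplacian p (fun y => spow (u y t) q) x.

(* Only the values u x t with 0 <= t are relevant. *)
Definition solution (p q r : R) (u0 : V -> R) (u : V -> R -> R) : Prop :=
  [/\ Linfty_lr r u,
      forall x, C1_halfline (u x),
      forall x, evolves_at p q u x
    & forall x, u x 0 = u0 x].

Definition mixed_solution (p q : R) (u0 : V -> R) (x0 : V) (n : nat)
    (u : V -> R -> R) : Prop :=
  [/\ forall x, C1_halfline (u x),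
      forall x, gball x0 n x -> evolves_at p q u x,
      forall x, gball x0 n x -> u x 0 = u0 x
    & forall x (t : R), ~ gball x0 n x -> 0 <= t -> u x t = 0].

Definition exhaustion_solution (p q r : R) (u0 : V -> R) (x0 : V)
    (u : V -> R -> R) : Prop :=
  solution p q r u0 u /\
  exists (nk : nat -> nat) (un : nat -> V -> R -> R),
    [/\ {homo nk : i j / (i < j)%N},
        forall k, (0 < nk k)%N,
        forall k, mixed_solution p q u0 x0 (nk k) (un k)
      & forall x (t : R), 0 <= t -> (fun k => un k x t) @ \oo --> u x t].

End graph_notions.

(* Main.v *)
Require Import Defs.
From HB Require Import structures.
From mathcomp Require Import all_boot all_order all_algebra.
From mathcomp Require Import all_classical all_reals all_analysis.
From mathcomp Require Import ring lra.

Set Implicit Arguments.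
Unset Strict Implicit.
Unset Printing Implicit Defensive.

Import Order.TTheory GRing.Theory Num.Theory.
Import numFieldNormedType.Exports.

Local Open Scope classical_set_scope.
Local Open Scope ring_scope.

(** Write [v = u^q] and [theta = 1 - p / d].  Testing the equation with
    [|u|^(m-2) u] shows that [Y = sum |u|^m mu] satisfies, formally,
    [Y' = - (m / 2) sum omega_xy |v_x - v_y|^(p-1) |u_x^(m-1) - u_y^(m-1)|],
    where the sum is over ordered pairs.
    The isoperimetric inequality gives the l^1 Sobolev inequality
    ([l1_sobolev]); applied to [|u|^(m(d-1)/d)], combined with an elementary
    inequality for two real numbers ([powR_gap]) and with Hoelder's inequality,
    it bounds this sum below by a multiple of [Y^theta].  The exponent [m] is the
    one for which all three steps are homogeneous.  As [theta < 1], the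
    differential inequality [Y' <= - c Y^theta] drives [Y] to 0 by the time
    [C Y(0)^(p/d)].

    On an infinite graph [Y] need not be finite at positive times, nor be
    differentiable.  Both difficulties disappear when the level [e > 0] is
    subtracted from the nonlinearities: [|u|^m] is replaced by the convex function
    [trunc_energy m e u], which vanishes for [|u| <= e].  A solution that is
    bounded in l^r is bounded, so its time derivatives are uniformly bounded, and
    on a bounded time interval only finitely many vertices ever exceed [e]
    ([solution_finite_support]).  The truncated energy is then a finite sum and
    decreases at the rate given by Green's formula ([energy_mvt]).

    The truncated functional does not satisfy a closed differential inequality,
    and none is needed.  If the mass is at most [A] at time [s] and still exceeds
    [A / 2] at time [t], then for small [e] the energy truncated at [2 e] exceeds
    [A / 2] on the whole interval, because it is nonincreasing; the energy
    truncated at [e] then dissipates at a rate of order [A^theta]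
    ([dissipation_lower_bound]), which is impossible for longer than a multiple of
    [A^(p/d)].  Hence the mass halves within such a time ([mass_halves]), and the
    halving times sum up to a geometric series ([solution_extinct]). *)

(** * Inequalities for real powers *)

Section powers.
Context {R : realType}.
Implicit Types a b x A B s p q m d e k : R.

Lemma powR_expR x s : (expR x) `^ s = expR (s * x).
Proof. by rewrite /powR gt_eqF ?expR_gt0// expRK. Qed.

Lemma ler_powR2r s x y : 0 <= s -> 0 <= x -> x <= y -> x `^ s <= y `^ s.
Proof.
move=> s0 x0 xy; apply: ge0_ler_powR => //; rewrite nnegrE //.
exact: le_trans xy.
Qed.

(** Bernoulli's inequality, as Young's inequality for [x] and [1]. *)
Lemma powR_ge_tangent s x : 1 <= s -> 0 <= x -> 1 + s * (x - 1) <= x `^ s.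
Proof.
move=> s1 x0; have [->|sn1] := eqVneq s 1; first by rewrite powRr1//; lra.
have s1' : 1 < s by rewrite lt_neqAle eq_sym sn1.
have s0 : 0 < s by lra.
have sE : s^-1 + (s / (s - 1))^-1 = 1 by field; apply/andP; split; lra.
have := @conjugate_powR R x 1 s (s / (s - 1)) x0 ler01 s0.
rewrite divr_gt0 ?subr_gt0// => /(_ isT sE).
rewrite powR1 mulr1 => h.
have : s * x <= s * (x `^ s / s + 1 / (s / (s - 1))) by rewrite ler_pM2l.
have -> : s * (x `^ s / s + 1 / (s / (s - 1))) = x `^ s + (s - 1).
  by field; apply/andP; split; lra.
by lra.
Qed.

Lemma powR_increment_unit s x : 0 < s -> 0 <= x <= 1 ->
  Num.min 1 s * (1 - x) <= 1 - x `^ s /\ 1 - x `^ s <= Num.max 1 s * (1 - x).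
Proof.
move=> s0 /andP[x0 x1]; have [s1|s1] := leP 1 s.
  split; last by have := powR_ge_tangent s1 x0; lra.
  have : x `^ s <= x; last by lra.
  move: x0; rewrite le_eqVlt => /predU1P[<-|x0]; first by rewrite powR0// gt_eqF.
  by apply: ge1r_powR => //; rewrite x0.
have is1 : 1 <= s^-1 by rewrite invf_ge1 ?ltW.
split.
  (* the tangent inequality for the inverse power, at the point x `^ s *)
  have := powR_ge_tangent is1 (powR_ge0 x s).
  rewrite -powRrM divff ?gt_eqF// powRr1// => h.
  have : s * (1 + s^-1 * (x `^ s - 1)) <= s * x by rewrite ler_pM2l.
  have -> : s * (1 + s^-1 * (x `^ s - 1)) = s + (x `^ s - 1) by field; lra.
  by lra.
have : x <= x `^ s; last by lra.
move: x0; rewrite le_eqVlt => /predU1P[<-|x0]; first exact: powR_ge0.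
by apply: ger1_powR; rewrite ?x0// ltW.
Qed.

(** The mean value bounds for the power function, with constants that do not
    depend on [B]; they are the case [A = 1] rescaled. *)
Lemma powR_increment s A B : 0 < s -> 0 < A -> 0 <= B <= A ->
  Num.min 1 s * (A `^ (s - 1) * (A - B)) <= A `^ s - B `^ s /\
  A `^ s - B `^ s <= Num.max 1 s * (A `^ (s - 1) * (A - B)).
Proof.
move=> s0 A0 /andP[B0 BA].
have x01 : 0 <= B / A <= 1 by rewrite divr_ge0 ?(ltW A0)//= ler_pdivrMr// mul1r.
have BE : B = A * (B / A) by rewrite mulrCA divff ?mulr1// gt_eqF.
have AE : A `^ (s - 1) * A = A `^ s by rewrite mulrC mulr_powRB1// ltW.
have E1 : A `^ (s - 1) * (A - B) = A `^ s * (1 - B / A).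
  by rewrite -AE; field; rewrite gt_eqF.
have E2 : A `^ s - B `^ s = A `^ s * (1 - (B / A) `^ s).
  by rewrite {1}BE powRM ?(ltW A0)//; [ring|case/andP: x01].
have As0 : 0 < A `^ s by rewrite powR_gt0.
have [h1 h2] := powR_increment_unit s0 x01.
rewrite E1 E2; split; rewrite mulrCA; exact: (ler_wpM2l (ltW As0)).
Qed.

(** The quotient of the mean value constants of the power functions in
    [powR_gap]. *)
Definition gap_const p q m g : R :=
  Num.max 1 g / (Num.min 1 q `^ ((p - 1) / p) * Num.min 1 (m - 1) `^ (p^-1)).

Lemma min1_gt0 s : 0 < s -> 0 < Num.min 1 s.
Proof. by move=> s0; rewrite lt_min ltr01. Qed.

Lemma max1_gt0 s : 0 < Num.max 1 s.
Proof. by rewrite lt_max ltr01. Qed.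

Lemma gap_const_gt0 p q m g : 1 < p -> 0 < q -> 1 < m -> 0 < gap_const p q m g.
Proof.
move=> p1 q0 m1; rewrite divr_gt0 ?max1_gt0// mulr_gt0// powR_gt0//.
  exact: min1_gt0.
by apply: min1_gt0; lra.
Qed.

(** Both sides are homogeneous of the same degree [g] in [(A, B)], and each
    difference of powers is comparable to
    [A - B] times a power of [A]. *)
Lemma powR_gap p q m g A B : 1 < p -> 0 < q -> 1 < m -> 0 < g ->
  g * p = q * (p - 1) + (m - 1) + m * (p - 1) ->
  0 < A -> 0 <= B <= A ->
  A `^ g - B `^ g <= gap_const p q m g *
    (((A `^ q - B `^ q) `^ (p - 1) * (A `^ (m - 1) - B `^ (m - 1))) `^ (p^-1)
     * (A `^ m) `^ ((p - 1) / p)).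
Proof.
move=> p1 q0 m1 g0 gE A0 BA.
have [q1 _] := powR_increment q0 A0 BA.
have m10 : 0 < m - 1 by lra.
have [m2 _] := powR_increment m10 A0 BA.
have [_ g1] := powR_increment g0 A0 BA.
have /andP[B0] := BA; rewrite le_eqVlt => /predU1P[->|BltA].
  rewrite !subrr; apply: mulr_ge0; first by rewrite ltW// gap_const_gt0.
  by rewrite mulr_ge0 ?powR_ge0.
have p0 : 0 < p by lra.
have cq0 := min1_gt0 q0; have cm0 := min1_gt0 m10.
have D0 : 0 < A - B by lra.
apply: (le_trans g1).
pose low := (Num.min 1 q * (A `^ (q - 1) * (A - B))) `^ (p - 1) *
            (Num.min 1 (m - 1) * (A `^ (m - 1 - 1) * (A - B))).
have low0 : 0 <= low by rewrite !mulr_ge0 ?powR_ge0// ltW.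
have lowP : low <=
    (A `^ q - B `^ q) `^ (p - 1) * (A `^ (m - 1) - B `^ (m - 1)).
  apply: ler_pM => //; rewrite ?powR_ge0//.
  - by rewrite !mulr_ge0 ?powR_ge0// ltW.
  - by apply: ler_powR2r => //; [lra|rewrite !mulr_ge0 ?powR_ge0// ltW].
have ip0 : 0 <= p^-1 by rewrite invr_ge0 ltW.
apply: (le_trans _ (ler_wpM2l (ltW (gap_const_gt0 g p1 q0 m1))
  (ler_wpM2r (powR_ge0 _ _) (ler_powR2r ip0 low0 lowP)))).
rewrite /low.
rewrite /gap_const -mulrA ler_wpM2l ?(ltW (max1_gt0 _))//.
(* all factors are positive, so the identity is linear in their logarithms *)
have toexp c : 0 < c -> exists x, c = expR x by exists (ln c); rewrite lnK.
have [x ->] := toexp _ cq0; have [y ->] := toexp _ cm0.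
have [z ->] := toexp _ D0; have [w ->] := toexp _ A0.
rewrite !(powR_expR, =^~ expRD, =^~ expRN) ler_expR.
have -> : g = (q * (p - 1) + (m - 1) + m * (p - 1)) / p.
  by rewrite -gE mulfK// gt_eqF.
rewrite le_eqVlt; apply/orP; left; apply/eqP; field; lra.
Qed.

End powers.

(** * Truncated powers *)

Section truncation.
Context {R : realType}.
Implicit Types a b x A B s p q m g k e : R.

Definition raise e a : R := Num.max `|a| e.

Definition trunc_pow g e a : R := raise e a `^ g - e `^ g.

(** The primitive of [trunc_slope] that vanishes on [[-e, e]]; as [e] tends to 0
    it increases to [`|a| `^ m]. *)
Definition trunc_energy m e a : R :=
  raise e a `^ m - m * e `^ (m - 1) * raise e a + (m - 1) * e `^ m.

(** This is [m * sgr a * (raise e a `^ (m - 1) - e `^ (m - 1))], written without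
    a sign so that its continuity and monotonicity are visible. *)
Definition trunc_slope m e a : R :=
  m * (Num.max a e `^ (m - 1) - Num.max (- a) e `^ (m - 1)).

Lemma raise_ge e a : e <= raise e a.
Proof. by rewrite le_max lexx orbT. Qed.

Lemma norm_le_raise e a : `|a| <= raise e a.
Proof. by rewrite le_max lexx. Qed.

Lemma raise_gt0 e a : 0 < e -> 0 < raise e a.
Proof. by move=> e0; apply: lt_le_trans (raise_ge e a). Qed.

Lemma raise_small e a : `|a| <= e -> raise e a = e.
Proof. by move=> ?; rewrite /raise max_r. Qed.

Lemma raise_large e a : e <= `|a| -> raise e a = `|a|.
Proof. by move=> ?; rewrite /raise max_l. Qed.

Lemma trunc_pow_small g e a : `|a| <= e -> trunc_pow g e a = 0.
Proof. by move=> h; rewrite /trunc_pow raise_small// subrr. Qed.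

Lemma trunc_pow_ge0 g e a : 0 < e -> 0 <= g -> 0 <= trunc_pow g e a.
Proof.
by move=> e0 g0; rewrite subr_ge0 ler_powR2r ?raise_ge// ltW.
Qed.

Lemma powR_succ x s : 0 < s -> 0 <= x -> x `^ s = x * x `^ (s - 1).
Proof. by move=> s0 x0; rewrite mulr_powRB1. Qed.

Lemma trunc_energy_small m e a : 0 < e -> 1 < m -> `|a| <= e ->
  trunc_energy m e a = 0.
Proof.
move=> e0 m1 h; rewrite /trunc_energy raise_small// (@powR_succ e m); [ring|lra|lra].
Qed.

Lemma norm_trunc_slope m e a : 0 < e -> 1 < m ->
  `|trunc_slope m e a| = m * (raise e a `^ (m - 1) - e `^ (m - 1)).
Proof.
move=> e0 m1; have m10 : 0 <= m - 1 by lra.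
have m0 : 0 <= m by lra.
have pos : 0 <= raise e a `^ (m - 1) - e `^ (m - 1).
  by rewrite subr_ge0 ler_powR2r ?raise_ge// ltW.
rewrite /trunc_slope normrM (ger0_norm m0); congr (_ * _).
have [a0|a0] := leP 0 a.
  rewrite (@max_r _ _ (- a) e) ?(le_trans _ (ltW e0)) ?oppr_le0//.
  by move: pos; rewrite /raise (ger0_norm a0) => /ger0_norm.
rewrite (@max_r _ _ a e); last lra.
by move: pos; rewrite /raise (ltr0_norm a0) distrC => /ger0_norm.
Qed.

Lemma trunc_slope_small m e a : 0 < e -> 1 < m -> `|a| <= e ->
  trunc_slope m e a = 0.
Proof.
move=> e0 m1 h; apply/eqP; rewrite -normr_eq0 norm_trunc_slope// raise_small//.
by rewrite subrr mulr0.
Qed.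

Lemma powR_maxr_homo s e a b : 0 <= s -> 0 <= e -> a <= b ->
  Num.max a e `^ s <= Num.max b e `^ s.
Proof.
move=> s0 e0 ab; apply: ler_powR2r; rewrite ?s0//; first by rewrite le_max e0 orbT.
by rewrite ge_max !le_max lexx ab !orbT.
Qed.

Lemma trunc_slope_homo m e : 0 < e -> 1 < m ->
  {homo trunc_slope m e : a b / a <= b}.
Proof.
move=> e0 m1 a b ab; rewrite /trunc_slope ler_wpM2l; [|lra|].
  by [].
by apply: lerB; apply: powR_maxr_homo; rewrite ?lerN2//; lra.
Qed.

Lemma trunc_slopeM m e a : 0 < e -> 1 < m ->
  trunc_slope m e a * a = `|trunc_slope m e a| * `|a|.
Proof.
move=> e0 m1; rewrite -normrM ger0_norm//.
have s0 : trunc_slope m e 0 = 0 by rewrite trunc_slope_small// normr0 ltW.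
have [a0|a0] := leP 0 a.
  by rewrite mulr_ge0// -s0 trunc_slope_homo.
by rewrite mulr_le0 ?(ltW a0)// -s0 trunc_slope_homo// ltW.
Qed.

(** Convexity of the power function, tangent at [A]. *)
Lemma powR_convex_tangent m A B : 1 < m -> 0 < A -> 0 <= B ->
  m * A `^ (m - 1) * (B - A) <= B `^ m - A `^ m.
Proof.
move=> m1 A0 B0; have := powR_ge_tangent (ltW m1) (_ : 0 <= B / A).
rewrite divr_ge0 ?(ltW A0)// => /(_ isT).
have Am : 0 < A `^ m by rewrite powR_gt0.
rewrite -(ler_pM2l Am) -powRM ?divr_ge0 ?(ltW A0)//.
rewrite (mulrCA A) divff ?gt_eqF// mulr1.
have -> : A `^ m * (1 + m * (B / A - 1)) = A `^ m + m * A `^ (m - 1) * (B - A).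
  rewrite (@powR_succ A m) ?(ltW A0)//; last lra.
  by field; rewrite gt_eqF.
by lra.
Qed.

(** [trunc_energy] is convex; since its slope is continuous, this inequality
    gives its differentiability without distinguishing the corners of [raise]. *)
Lemma trunc_energy_subgradient m e a b : 0 < e -> 1 < m ->
  trunc_slope m e a * (b - a) <= trunc_energy m e b - trunc_energy m e a.
Proof.
move=> e0 m1; rewrite mulrBr trunc_slopeM//.
have h1 : trunc_slope m e a * b <= `|trunc_slope m e a| * raise e b.
  rewrite (le_trans (ler_norm _))// normrM ler_wpM2l//; exact: norm_le_raise.
have h2 : `|trunc_slope m e a| * `|a| = `|trunc_slope m e a| * raise e a.
  have [h|h] := leP `|a| e; first by rewrite trunc_slope_small// normr0 !mul0r.
  by rewrite raise_large// ltW.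
have := powR_convex_tangent m1 (raise_gt0 a e0) (ltW (raise_gt0 b e0)).
move: h1 h2; rewrite norm_trunc_slope// /trunc_energy.
set A := raise e a; set B := raise e b; move: (trunc_slope m e a * b) => X.
by move=> h1 -> h3; nra.
Qed.

Lemma trunc_energy_ge0 m e a : 0 < e -> 1 < m -> 0 <= trunc_energy m e a.
Proof.
move=> e0 m1; have := trunc_energy_subgradient 0 a e0 m1.
have n0 : `|0 : R| <= e by rewrite normr0 ltW.
by rewrite trunc_slope_small// (trunc_energy_small e0 m1 n0) mul0r subr0.
Qed.

Lemma trunc_energy_le m e a : 0 < e -> 1 < m -> trunc_energy m e a <= `|a| `^ m.
Proof.
move=> e0 m1; have [h|h] := leP `|a| e.
  by rewrite trunc_energy_small// powR_ge0.
rewrite /trunc_energy raise_large ?(ltW h)// (@powR_succ e m) ?(ltW e0)//; last lra.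
have : 0 <= e `^ (m - 1) by exact: powR_ge0.
move: (e `^ (m - 1)) => E E0.
have h1 : 0 <= m * E * (`|a| - e) + E * e.
  by rewrite addr_ge0 ?mulr_ge0//; lra.
rewrite -subr_ge0; move: h1; congr (_ <= _); ring.
Qed.

Lemma norm_powR_le_trunc_energy m e a : 0 < e -> 1 < m ->
  `|a| `^ m <= trunc_energy m e a + m * e `^ (m - 1) * `|a|.
Proof.
move=> e0 m1; have [h|h] := leP `|a| e.
  rewrite trunc_energy_small// add0r (@powR_succ _ m)//; last lra.
  have : `|a| `^ (m - 1) <= e `^ (m - 1) by rewrite ler_powR2r//; lra.
  have := powR_ge0 e (m - 1); have := normr_ge0 a.
  move: (`|a|) (e `^ _) (`|a| `^ _) => x y z *.
  have : z * x <= y * x by rewrite ler_wpM2r.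
  have : 0 <= (m - 1) * (y * x) by rewrite !mulr_ge0//; lra.
  by lra.
rewrite /trunc_energy raise_large ?(ltW h)//.
have : 0 <= (m - 1) * e `^ m by rewrite mulr_ge0 ?powR_ge0//; lra.
by lra.
Qed.

(** Truncating the energy at twice the level makes it comparable to a power of
    [trunc_pow]: for [`|a| > 2 * e], subtracting [e `^ g] costs only a constant
    factor. *)
Lemma trunc_energy_half m g k e a : 0 < e -> 1 < m -> 0 < g -> 0 < k ->
  g * k = m ->
  trunc_energy m (2 * e) a <= (trunc_pow g e a / (1 - 2^-1 `^ g)) `^ k.
Proof.
move=> e0 m1 g0 k0 gk; have [h|h] := leP `|a| (2 * e).
  by rewrite trunc_energy_small ?powR_ge0//; lra.
apply: le_trans (trunc_energy_le _ _ m1) _; first lra.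
rewrite -gk powRrM; apply: ler_powR2r; [exact: ltW|exact: powR_ge0|].
have h2 : 2^-1 `^ g < 1 :> R.
  have E1 : 1 `^ g = 1 :> R by rewrite powR1.
  rewrite -[X in _ < X]E1.
  by apply: gt0_ltr_powR => //; rewrite ?nnegrE; lra.
rewrite ler_pdivlMr ?subr_gt0// /trunc_pow raise_large; last lra.
rewrite mulrBr mulr1 -powRM//.
have : e `^ g <= (`|a| * 2^-1) `^ g by apply: ler_powR2r; rewrite ?ler_pdivlMr//; lra.
by lra.
Qed.

Lemma spowE q a : 0 < q -> spow a q = Num.max a 0 `^ q - Num.max (- a) 0 `^ q.
Proof.
move=> q0; rewrite /spow.
have [a0|a0|->] := ltgtP a 0.
- rewrite ltr0_norm// max_l; last lra.
  rewrite powR0 ?gt_eqF// (@powR_succ (- a) q)//; [ring|lra].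
- rewrite gtr0_norm// max_r; last lra.
  by rewrite powR0 ?gt_eqF// (@powR_succ a q)//; [ring|lra].
- by rewrite oppr0 maxxx mulr0 subrr.
Qed.

Lemma spow_homo q : 0 < q -> {homo (fun a => spow a q) : a b / a <= b}.
Proof.
move=> q0 a b ab /=; rewrite !spowE//.
by apply: lerB; apply: powR_maxr_homo; rewrite ?lerN2//; lra.
Qed.

Lemma norm_spow q a : 0 < q -> `|spow a q| = `|a| `^ q.
Proof.
move=> q0; rewrite /spow normrM ger0_norm ?powR_ge0// mulrC mulr_powRB1//.
Qed.

(** [powR_gap] for arguments of any sign.  By symmetry [`|b| <= `|a|], and only
    [`|a| > e] matters; the bound at [`|a|] and [raise e b] suffices because
    raising [`|b|] decreases the gap of the untruncated power [q]. *)
Lemma trunc_gap p q m g e a b : 1 < p -> 0 < q -> 1 < m -> 0 < g -> 0 < e ->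
  g * p = q * (p - 1) + (m - 1) + m * (p - 1) ->
  `|trunc_pow g e a - trunc_pow g e b| <= gap_const p q m g *
    ((`|spow a q - spow b q| `^ (p - 1) *
      `|trunc_slope m e a - trunc_slope m e b|) `^ (p^-1)
     * (`|a| `^ m + `|b| `^ m) `^ ((p - 1) / p)).
Proof.
move=> p1 q0 m1 g0 e0 gE; wlog ba : a b / `|b| <= `|a|.
  move=> H; have [/H//|/ltW/H] := leP `|b| `|a|.
  by rewrite distrC (distrC (spow b q)) (distrC (trunc_slope m e b)) (addrC (`|b| `^ m)).
have K0 := gap_const_gt0 g p1 q0 m1.
have p0 : 0 < p by lra.
have [ae|ea] := leP `|a| e.
  rewrite !trunc_pow_small// ?(le_trans ba)// subrr normr0.
  by apply: mulr_ge0; [exact: ltW|rewrite mulr_ge0 ?powR_ge0].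
have bl : 0 <= raise e b <= `|a| by rewrite ltW ?raise_gt0//= ge_max ba ltW.
have a0 : 0 < `|a| by lra.
have m10 : 0 <= m - 1 by lra.
have := powR_gap p1 q0 m1 g0 gE a0 bl.
have -> : `|trunc_pow g e a - trunc_pow g e b| = `|a| `^ g - raise e b `^ g.
  rewrite /trunc_pow raise_large ?(ltW ea)// opprB addrA subrK ger0_norm//.
  by case/andP: bl => rb0 bl; rewrite subr_ge0; apply: ler_powR2r => //; apply: ltW.
move=> /le_trans; apply; rewrite ler_wpM2l ?(ltW K0)//.
case/andP: bl => b0 bl.
apply: ler_pM; rewrite ?powR_ge0//; last first.
  by apply: ler_powR2r; rewrite ?powR_ge0 ?lerDl ?powR_ge0// divr_ge0//; lra.
have qq : raise e b `^ q <= `|a| `^ q by rewrite ler_powR2r// ltW.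
have mm : raise e b `^ (m - 1) <= `|a| `^ (m - 1) by rewrite ler_powR2r.
apply: ler_powR2r; first by rewrite invr_ge0 ltW.
  by rewrite mulr_ge0 ?powR_ge0// subr_ge0.
apply: ler_pM; rewrite ?powR_ge0 ?subr_ge0//.
  apply: ler_powR2r; [lra|by rewrite subr_ge0|].
  apply: le_trans (lerB_dist _ _); rewrite !norm_spow// lerB//.
  by rewrite ler_powR2r ?norm_le_raise// ltW.
apply: le_trans (lerB_dist _ _); rewrite !norm_trunc_slope//.
rewrite (@raise_large e a) ?(ltW ea)// -mulrBr.
rewrite opprB addrA subrK ler_peMl ?subr_ge0//; lra.
Qed.

End truncation.

(** * Hölder and Minkowski inequalities for finite sums *)

Section finite_sums.
Context {R : realType} {I : Type}.
Variables (s : seq I) (w : I -> R).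
Hypothesis w0 : forall i, 0 <= w i.

(** Young's inequality in the normalization that sums to Hoelder's. *)
Lemma young_powR (p x y P Q : R) : 1 < p -> 0 <= x -> 0 <= y -> 0 < P -> 0 < Q ->
  x `^ p^-1 * y `^ ((p - 1) / p) <=
  P `^ p^-1 * Q `^ ((p - 1) / p) * (x / P / p + y / Q * ((p - 1) / p)).
Proof.
move=> p1 x0 y0 P0 Q0.
have p0 : 0 < p by lra.
have cpr : p^-1 + (p / (p - 1))^-1 = 1 by field; apply/andP; split; lra.
have := @conjugate_powR R ((x / P) `^ p^-1) ((y / Q) `^ ((p - 1) / p)) p
  (p / (p - 1)) (powR_ge0 _ _) (powR_ge0 _ _) p0.
rewrite divr_gt0 ?subr_gt0// => /(_ isT cpr).
have pp : (p - 1) / p * (p / (p - 1)) = 1 by field; apply/andP; split; lra.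
rewrite -!powRrM mulVf ?gt_eqF// pp !powRr1 ?divr_ge0 ?(ltW P0) ?(ltW Q0)// !invf_div => h.
have xE : x = P * (x / P) by rewrite mulrCA divff ?mulr1// gt_eqF.
have yE : y = Q * (y / Q) by rewrite mulrCA divff ?mulr1// gt_eqF.
have xP : 0 <= x / P by rewrite divr_ge0// ltW.
have yQ : 0 <= y / Q by rewrite divr_ge0// ltW.
rewrite {1}xE {1}yE (powRM _ (ltW P0) xP) (powRM _ (ltW Q0) yQ).
by rewrite mulrACA ler_wpM2l// mulr_ge0 ?powR_ge0.
Qed.

(** Only upper bounds [P] and [Q] for the two sums are used, which avoids the
    degenerate case where a sum vanishes. *)
Lemma hoelder_sum (p P Q : R) (X Z : I -> R) : 1 < p ->
  (forall i, 0 <= X i) -> (forall i, 0 <= Z i) -> 0 < P -> 0 < Q ->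
  \sum_(i <- s) w i * X i <= P -> \sum_(i <- s) w i * Z i <= Q ->
  \sum_(i <- s) w i * (X i `^ p^-1 * Z i `^ ((p - 1) / p)) <=
  P `^ p^-1 * Q `^ ((p - 1) / p).
Proof.
move=> p1 X0 Z0 P0 Q0 hX hZ; set c := P `^ _ * _.
have c0 : 0 <= c by rewrite mulr_ge0 ?powR_ge0.
apply: (@le_trans _ _ (c * ((\sum_(i <- s) w i * X i) / P / p +
                      (\sum_(i <- s) w i * Z i) / Q * ((p - 1) / p)))).
  rewrite !mulr_suml -big_split mulr_sumr /=; apply: ler_sum => i _.
  apply: le_trans (ler_wpM2l (w0 i) (young_powR p1 (X0 i) (Z0 i) P0 Q0)) _.
  by rewrite -/c le_eqVlt; apply/orP; left; apply/eqP; ring.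
rewrite ler_piMr//.
have h1 : (\sum_(i <- s) w i * X i) / P <= 1 by rewrite ler_pdivrMr// mul1r.
have h2 : (\sum_(i <- s) w i * Z i) / Q <= 1 by rewrite ler_pdivrMr// mul1r.
have ip : 0 <= p^-1 by rewrite invr_ge0; lra.
have ip' : 0 <= (p - 1) / p by rewrite mulr_ge0//; lra.
apply: (@le_trans _ _ (1 * p^-1 + 1 * ((p - 1) / p))).
  by rewrite lerD// ler_wpM2r.
by rewrite le_eqVlt; apply/orP; left; apply/eqP; field; lra.
Qed.

Lemma powR_convex (r l k x y : R) : 1 < r -> 0 <= l -> 0 <= k -> l + k = 1 ->
  0 <= x -> 0 <= y -> (l * x + k * y) `^ r <= l * x `^ r + k * y `^ r.
Proof.
move=> r1 l0 k0 lk x0 y0.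
have := addr_ge0 (mulr_ge0 l0 x0) (mulr_ge0 k0 y0).
rewrite le_eqVlt => /predU1P[<-|z0].
  by rewrite powR0 ?addr_ge0 ?mulr_ge0 ?powR_ge0//; lra.
have hx := powR_convex_tangent r1 z0 x0.
have hy := powR_convex_tangent r1 z0 y0.
have := lerD (ler_wpM2l l0 hx) (ler_wpM2l k0 hy).
set z := l * x + k * y; set D := r * _.
have -> : l * (D * (x - z)) + k * (D * (y - z)) = D * (l * x + k * y - (l + k) * z).
  by ring.
rewrite lk mul1r subrr mulr0 !mulrBr addrACA -opprD -mulrDl lk mul1r.
by rewrite subr_ge0.
Qed.

Lemma minkowski_sum (r a b : R) (f g : I -> R) : 1 < r ->
  (forall i, 0 <= f i) -> (forall i, 0 <= g i) -> 0 < a -> 0 < b ->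
  \sum_(i <- s) f i `^ r * w i <= a `^ r ->
  \sum_(i <- s) g i `^ r * w i <= b `^ r ->
  \sum_(i <- s) (f i + g i) `^ r * w i <= (a + b) `^ r.
Proof.
move=> r1 f0 g0 a0 b0 hf hg; have ab0 : 0 < a + b by rewrite addr_gt0.
have ar0 : 0 < a `^ r by rewrite powR_gt0.
have br0 : 0 < b `^ r by rewrite powR_gt0.
have c0 : 0 <= (a + b) `^ r by exact: powR_ge0.
set l := a / (a + b); set k := b / (a + b).
have l0 : 0 <= l by rewrite divr_ge0 ?ltW.
have k0 : 0 <= k by rewrite divr_ge0 ?ltW.
have lk : l + k = 1 by rewrite /l /k; field; rewrite gt_eqF.
apply: (@le_trans _ _ ((a + b) `^ r * (l * ((\sum_(i <- s) f i `^ r * w i) / a `^ r)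
   + k * ((\sum_(i <- s) g i `^ r * w i) / b `^ r)))).
  rewrite !mulr_suml !mulr_sumr -big_split mulr_sumr /=; apply: ler_sum => i _.
  have -> : f i + g i = (a + b) * (l * (f i / a) + k * (g i / b)).
    by rewrite /l /k; field; rewrite !gt_eqF.
  have fa : 0 <= f i / a by rewrite divr_ge0// ltW.
  have gb : 0 <= g i / b by rewrite divr_ge0// ltW.
  rewrite (powRM _ (ltW ab0) (addr_ge0 (mulr_ge0 l0 fa) (mulr_ge0 k0 gb))).
  rewrite -mulrA ler_wpM2l//.
  apply: le_trans (ler_wpM2r (w0 i) (powR_convex r1 l0 k0 lk fa gb)) _.
  have divE x y : 0 <= x -> 0 < y -> (x / y) `^ r = x `^ r / y `^ r.
    move=> x0 y0; rewrite powRM ?invr_ge0 ?(ltW y0)//; congr (_ * _).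
    by rewrite -(powR_inv1 (ltW y0)) -powRrM mulN1r powRN.
  rewrite (divE _ _ (f0 i) a0) (divE _ _ (g0 i) b0).
  rewrite le_eqVlt; apply/orP; left; apply/eqP; ring.
rewrite ler_piMr// -lk lerD//.
  by rewrite ler_piMr// ler_pdivrMr// mul1r.
by rewrite ler_piMr// ler_pdivrMr// mul1r.
Qed.

End finite_sums.

(** * Finite parts of a weighted graph *)

Section graph.
Context {R : realType} {V : countType}.
Variable G : wgraph R V.
Implicit Types (x y : V) (N : seq V).

(** At such a vertex the degree and the Laplacian are sums over [N]. *)
Definition interior N x := x \in N /\ forall y, Defs.adjacent G x y -> y \in N.

Lemma weight_nonadjacent x y : ~ Defs.adjacent G x y -> G x y = 0.
Proof.
move=> /negP; rewrite /Defs.adjacent -leNgt => h; apply/eqP.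
by rewrite eq_le h weight_ge0.
Qed.

Lemma wdegreeE N x : uniq N -> (forall y, Defs.adjacent G x y -> y \in N) ->
  wdegree G x = \sum_(y <- N) G x y.
Proof.
move=> uN h; apply: fsbig_fwiden => //.
by move=> y [_ /= /weight_nonadjacent].
Qed.

Lemma wdegree_ge_sum N x : uniq N -> \sum_(y <- N) G x y <= wdegree G x.
Proof.
move=> uN; have /finite_seqP[s sE] := wgraph_locally_finite G x.
have uM : uniq (N ++ [seq y <- undup s | y \notin N]).
  rewrite cat_uniq uN filter_uniq ?undup_uniq// andbT.
  by apply/hasPn => y; rewrite mem_filter => /andP[].
rewrite (wdegreeE uM) => [|y xy].
  by rewrite big_cat lerDl sumr_ge0// => y _; exact: weight_ge0.
have ys : y \in s by have : [set y | Defs.adjacent G x y] y by []; rewrite sE.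
by rewrite mem_cat mem_filter mem_undup ys andbT orbN.
Qed.

Lemma wdegree_ge0 x : 0 <= wdegree G x.
Proof. by apply: fsumr_ge0 => y _; exact: weight_ge0. Qed.

Lemma wdegree_ge_inf x : inf (range (wdegree G)) <= wdegree G x.
Proof.
apply: ge_inf; last by exists x.
by exists 0 => _ [y _ <-]; exact: wdegree_ge0.
Qed.

Lemma wdegree_gt0 x : 0 < wdegree G x.
Proof. exact: lt_le_trans (wgraph_inf_degree_gt0 G) (wdegree_ge_inf x). Qed.

Lemma finite_interior (S : seq V) :
  exists2 N, uniq N & {in S, forall x, interior N x}.
Proof.
elim: S => [|x S [N uN hN]]; first by exists [::].
have /finite_seqP[s sE] := wgraph_locally_finite G x.
exists (undup (x :: s ++ N)); first exact: undup_uniq.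
move=> y; rewrite inE => /predU1P[->|/hN[yN yh]].
  split; first by rewrite mem_undup inE eqxx.
  move=> z xz; rewrite mem_undup inE mem_cat.
  have -> : z \in s by have : [set y | Defs.adjacent G x y] z by []; rewrite sE.
  by rewrite orbT.
split; first by rewrite mem_undup inE mem_cat yN !orbT.
by move=> z /yh zN; rewrite mem_undup inE mem_cat zN !orbT.
Qed.

Lemma sum_by_parts N (f : V -> R) (J : V -> V -> R) :
  (forall x y, J x y = - J y x) ->
  \sum_(x <- N) \sum_(y <- N) f x * J x y =
  - (2^-1 * \sum_(x <- N) \sum_(y <- N) (f y - f x) * J x y).
Proof.
move=> JN; set A := LHS.
have E : \sum_(x <- N) \sum_(y <- N) f y * J x y = - A.
  rewrite exchange_big /A -sumrN; apply: eq_bigr => x _.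
  by rewrite -sumrN; apply: eq_bigr => y _; rewrite JN mulrN.
have -> : \sum_(x <- N) \sum_(y <- N) (f y - f x) * J x y = - A - A.
  rewrite -{1}E /A -sumrB; apply: eq_bigr => x _.
  by rewrite -sumrB; apply: eq_bigr => y _; rewrite mulrBl.
by field.
Qed.

Lemma plaplacian_interior p N (v : V -> R) x : uniq N -> interior N x ->
  wdegree G x * plaplacian G p v x =
  \sum_(y <- N) (`|v y - v x| `^ (p - 2) * (v y - v x) * G x y).
Proof.
move=> uN [xN h]; rewrite mulrA divff ?mul1r ?gt_eqF ?wdegree_gt0//.
apply/esym; rewrite (fsbig_seq _ _ uN); apply: fsbig_widen => // y [_ /= yN].
by rewrite weight_nonadjacent ?mulr0// => /h.
Qed.

(** Green's formula.  For comonotone [f] and [v] each term of the energy form is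
    nonnegative, so the form is a sum of products of absolute values. *)
Lemma green_comonotone p N (f v : V -> R) : uniq N -> 1 < p ->
  (forall x, f x != 0 -> interior N x) ->
  (forall x y, 0 <= (f y - f x) * (v y - v x)) ->
  \sum_(x <- N) wdegree G x * (f x * plaplacian G p v x) =
  - (2^-1 * \sum_(x <- N) \sum_(y <- N)
     G x y * (`|v x - v y| `^ (p - 1) * `|f x - f y|)).
Proof.
move=> uN p1 hf fv.
pose J x y := `|v y - v x| `^ (p - 2) * (v y - v x) * G x y.
transitivity (\sum_(x <- N) \sum_(y <- N) f x * J x y).
  apply: eq_bigr => x _; rewrite -mulr_sumr mulrCA.
  have [->|/hf xN] := eqVneq (f x) 0; first by rewrite !mul0r.
  by rewrite (plaplacian_interior _ _ uN xN).
rewrite sum_by_parts => [|x y]; last first.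
  rewrite /J distrC (weight_sym G y x); ring.
congr (- (_ * _)); apply: eq_bigr => x _; apply: eq_bigr => y _.
rewrite /J (distrC (v x)) (distrC (f x)).
have -> : `|v y - v x| `^ (p - 1) = `|v y - v x| `^ (p - 2) * `|v y - v x|.
  rewrite (@powR_succ _ _ (p - 1))//; last lra.
  by rewrite mulrC; congr (_ `^ _ * _); lra.
have -> : forall a b : R, a * (b * `|v y - v x| * `|f y - f x|) =
    b * (`|v y - v x| * `|f y - f x|) * a by move=> *; ring.
rewrite -normrM (mulrC (v y - v x)) ger0_norm//; ring.
Qed.

(** * The l^1 Sobolev inequality *)

(** Each boundary edge occurs in both orders in the double sum. *)
Lemma mu_E_boundary N (S : {pred V}) : uniq N ->
  {in S, forall x, interior N x} ->
  mu_E G (edge_boundary G [set` S]) =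
  2^-1 * \sum_(x <- N) \sum_(y <- N) G x y * `|(x \in S)%:R - (y \in S)%:R|.
Proof.
move=> uN hS; pose r := [seq (x, y) | x <- N, y <- N].
have ur : uniq r by apply: allpairs_uniq => // -[x y] [x' y'].
have -> : mu_E G (edge_boundary G [set` S]) =
    \sum_(x <- N) \sum_(y <- N) G x y * ((x \in S) && (y \notin S))%:R.
  rewrite /mu_E -[edge_boundary _ _]set_mem_set -(@bigfs _ _ _ _ r)//; last first.
    move=> [x y]; rewrite inE => -[/= xy xS _] /negP[]; apply/allpairsP.
    exists (x, y) => /=.
    by have [xN h] := hS _ xS; split=> //; exact: h.
  rewrite big_mkcond /r big_allpairs; apply: eq_bigr => x _.
  apply: eq_bigr => y _ /=; case: ifPn; rewrite ?notin_setE ?inE /=.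
    by case=> /= _ xS /negP yS; rewrite [X in X && _](_ : _ = true)// yS mulr1.
  case: (boolP (x \in S)) => xS; last by rewrite mulr0.
  case: (boolP (y \in S)) => yS; first by rewrite mulr0.
  move=> h; rewrite mulr1 weight_nonadjacent// => xy.
  by apply: h; split => //=; exact/negP.
set A := LHS.
have E : A = \sum_(x <- N) \sum_(y <- N) G x y * ((y \in S) && (x \notin S))%:R.
  rewrite exchange_big; apply: eq_bigr => x _; apply: eq_bigr => y _.
  by rewrite weight_sym.
have -> : \sum_(x <- N) \sum_(y <- N) G x y * `|(x \in S)%:R - (y \in S)%:R| = A + A.
  rewrite {2}E -big_split; apply: eq_bigr => x _; rewrite -big_split.
  apply: eq_bigr => y _ /=.
  case: (x \in S); case: (y \in S) => /=;
    rewrite ?subrr ?normr0 ?subr0 ?sub0r ?normrN ?normr1 ?mulr0 ?mulr1 ?addr0 ?add0r//.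
by field.
Qed.

Lemma mu_V_seq N (S : {pred V}) : uniq N -> {in S, forall x, x \in N} ->
  mu_V G [set` S] = \sum_(x <- N) (x \in S)%:R * wdegree G x.
Proof.
move=> uN h; rewrite /mu_V -(bigfs _ uN)//; last by move=> x /h ->.
rewrite big_mkcond; apply: eq_bigr => x _; rewrite unfold_in.
by case: (S x); rewrite ?mul1r ?mul0r.
Qed.

Lemma seq_has_min (T : eqType) (f : T -> R) (s : seq T) : s != [::] ->
  exists2 x : T, x \in s & {in s, forall y : T, f x <= f y}.
Proof.
elim: s => // x [|y s] IH _.
  by exists x => [|z]; rewrite inE // => /eqP->.
have [z zs zmin] := IH isT; have [xz|zx] := leP (f x) (f z).
  exists x; rewrite ?mem_head// => u; rewrite inE => /predU1P[->//|us].
  exact: le_trans xz (zmin _ us).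
exists z; first by rewrite inE zs orbT.
move=> u; rewrite inE => /predU1P[->|/zmin//].
exact: ltW.
Qed.

Lemma ltn_count (T : eqType) (a b : pred T) (s : seq T) (x : T) : subpred a b ->
  x \in s -> b x -> ~~ a x -> (count a s < count b s)%N.
Proof.
move=> ab xs bx ax; elim: s xs => // y s IH; rewrite inE => /predU1P[<-|/IH lt] /=.
  by rewrite bx (negbTE ax) add0n add1n ltnS sub_count.
rewrite -addnS; apply: leq_add lt.
by case: (boolP (a y)) => // /ab ->.
Qed.

(** Gagliardo's argument in discrete form: subtracting the least positive value
    [t] of [g] on its support [S] splits the total variation of [g] exactly into
    that of [g - t 1_S] and [t] times the boundary of [S]; Minkowski's inequality
    adds the two norms, and the support shrinks.  The strict bound [B] leaves a
    positive amount for both summands. *)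
Lemma l1_sobolev d C N (g : V -> R) (B : R) : isoperimetric G d C -> 0 < C ->
  1 < d -> uniq N -> (forall x, 0 <= g x) ->
  (forall x, g x != 0 -> interior N x) ->
  C * (2^-1 * \sum_(x <- N) \sum_(y <- N) G x y * `|g x - g y|) < B ->
  \sum_(x <- N) g x `^ (d / (d - 1)) * wdegree G x <= B `^ (d / (d - 1)).
Proof.
move=> iso C0 d1 uN.
have d0 : 0 < d by lra.
have r1 : 1 < d / (d - 1) by rewrite ltr_pdivlMr; lra.
set r := d / (d - 1) in r1 *.
have [n] := ubnP (count (fun x => g x != 0) N).
elim: n g B => // n IH g B; rewrite ltnS => leN g0 gN ltB.
have [/hasP[z zN gz]|/hasPn gz] := boolP (has (fun x => g x != 0) N); last first.
  rewrite big1_seq ?powR_ge0// => x /= xN; have := gz x xN; rewrite negbK => /eqP->.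
  by rewrite powR0 ?mul0r// gt_eqF//; lra.
pose S : {pred V} := [pred x | g x != 0].
have [x1 [x1N gx1 xmin]] : exists x1, [/\ x1 \in N, g x1 != 0 &
    forall x, g x != 0 -> g x1 <= g x].
  have : [seq x <- N | g x != 0] != [::].
    by rewrite -has_filter; apply/hasP; exists z.
  case/(seq_has_min g) => x1; rewrite mem_filter => /andP[gx1 x1N] xmin.
  exists x1; split=> // x gx; apply: xmin; rewrite mem_filter gx.
  by case: (gN _ gx).
set t := g x1 in xmin gx1.
have t0 : 0 < t by rewrite lt_neqAle eq_sym gx1 g0.
pose h x := g x - t * (x \in S)%:R.
have h0 x : 0 <= h x.
  rewrite /h inE; have [->|gx] := eqVneq (g x) 0; first by rewrite mulr0 subr0.
  by rewrite mulr1 subr_ge0 xmin.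
have hg x : h x != 0 -> g x != 0.
  by apply: contraNN => /eqP gx; rewrite /h inE gx eqxx mulr0 subr0.
have hN x : h x != 0 -> interior N x by move=> /hg /gN.
have SN : {in S, forall x, interior N x} by move=> x; rewrite inE => /gN.
have lth : (count (fun x => h x != 0%R) N < n)%N.
  apply: leq_trans leN; apply: (@ltn_count _ (fun x => h x != 0) _ _ x1) => //=.
  by rewrite /h inE gx1 mulr1 subrr negbK.
set Vh := \sum_(x <- N) \sum_(y <- N) G x y * `|h x - h y|.
have split_var : \sum_(x <- N) \sum_(y <- N) G x y * `|g x - g y| =
    Vh + t * \sum_(x <- N) \sum_(y <- N) G x y * `|(x \in S)%:R - (y \in S)%:R|.
  rewrite mulr_sumr -big_split; apply: eq_bigr => x _ /=.
  rewrite mulr_sumr -big_split; apply: eq_bigr => y _ /=.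
  rewrite mulrCA -mulrDr; congr (_ * _); rewrite /h !inE.
  have hx := h0 x; have hy := h0 y; move: hx hy; rewrite /h !inE.
  have [->|gx] := eqVneq (g x) 0; have [->|gy] := eqVneq (g y) 0 => /= hx hy;
    rewrite ?(mulr0, mulr1, subr0, sub0r, subrr, normr0, addr0, normrN, normr1)//.
  - move: hy; rewrite mulr1 => hy.
    by rewrite oppr0 sub0r normrN (ger0_norm hy) (ger0_norm (g0 y)); lra.
  - move: hx; rewrite mulr1 => hx.
    by rewrite oppr0 subr0 (ger0_norm hx) (ger0_norm (g0 x)); lra.
  - by congr (`| _ |); ring.
pose b := t * (C * mu_E G (edge_boundary G [set` S])).
(* [b] bounds the norm of [t 1_S] *)
have isoS : mu_V G [set` S] `^ ((d - 1) / d) <=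
    C * mu_E G (edge_boundary G [set` S]).
  apply: iso; apply: (@sub_finite_set _ _ [set` N]); last exact: finite_seq.
  by move=> x /= /SN[].
have muS0 : 0 < mu_V G [set` S].
  rewrite (mu_V_seq uN); last by move=> x /SN[].
  apply: lt_le_trans (wdegree_gt0 x1) _.
  rewrite (big_rem x1)//= inE gx1 mul1r lerDl sumr_ge0// => x _.
  by rewrite mulr_ge0 ?wdegree_ge0.
have b0 : 0 < b.
  by rewrite mulr_gt0//; apply: lt_le_trans isoS; rewrite powR_gt0.
have ltBb : C * (2^-1 * Vh) < B - b.
  rewrite ltrBrDr; move: ltB; rewrite split_var /b (mu_E_boundary uN SN).
  by congr (_ < _); ring.
have Bb0 : 0 < B - b.
  apply: le_lt_trans ltBb; rewrite !mulr_ge0 ?(ltW C0)// ?invr_ge0//.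
  by rewrite !sumr_ge0// => x _; rewrite sumr_ge0// => y _; rewrite mulr_ge0 ?weight_ge0.
have := IH h _ lth h0 hN ltBb => {}IH.
rewrite -(subrK b B).
have -> : \sum_(x <- N) g x `^ r * wdegree G x =
    \sum_(x <- N) (h x + t * (x \in S)%:R) `^ r * wdegree G x.
  by apply: eq_bigr => x _; rewrite subrK.
apply: minkowski_sum => //.
- exact: wdegree_ge0.
- by move=> x; rewrite mulr_ge0// ltW.
have -> : \sum_(x <- N) (t * (x \in S)%:R) `^ r * wdegree G x =
    t `^ r * mu_V G [set` S].
  rewrite (mu_V_seq uN) ?mulr_sumr; last by move=> x /SN[].
  apply: eq_bigr => x _; case: (x \in S); rewrite ?mulr1 ?mul1r// !mulr0 powR0 ?mul0r ?mulr0//.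
  by rewrite gt_eqF//; lra.
rewrite powRM ?(ltW t0)//; last first.
  by apply: le_trans isoS; exact: powR_ge0.
rewrite ler_wpM2l ?powR_ge0//.
have := ler_powR2r (ltW (lt_trans ltr01 r1)) (powR_ge0 _ _) isoS.
have e1 : (d - 1) / d * r = 1 by rewrite /r; field; apply/andP; split; lra.
by rewrite -powRrM e1 powRr1// ltW.
Qed.

End graph.

(** * Dissipation of the truncated energy *)

Section dissipation.
Context {R : realType} {V : countType}.
Variable G : wgraph R V.
Implicit Types (x y : V) (N : seq V) (p q m d C e A : R).

(** Twice the rate at which [trunc_energy m e] of a solution with values [a]
    decreases. *)
Definition dissipation p q m e N (a : V -> R) : R :=
  \sum_(x <- N) \sum_(y <- N) G x y *
    (`|spow (a x) q - spow (a y) q| `^ (p - 1) *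
     `|trunc_slope m e (a x) - trunc_slope m e (a y)|).

Lemma dissipation_ge0 p q m e N a : 0 <= dissipation p q m e N a.
Proof.
rewrite !sumr_ge0// => x _; rewrite sumr_ge0// => y _.
by rewrite !mulr_ge0 ?powR_ge0 ?weight_ge0.
Qed.

Lemma sum_weight_add_le N (f : V -> R) : uniq N -> (forall x, 0 <= f x) ->
  \sum_(x <- N) \sum_(y <- N) G x y * (f x + f y) <=
  2 * \sum_(x <- N) f x * wdegree G x.
Proof.
move=> uN f0; set S := \sum_(x <- N) f x * _.
have h : \sum_(x <- N) \sum_(y <- N) G x y * f x <= S.
  apply: ler_sum => x _; rewrite -mulr_suml mulrC ler_wpM2l//.
  exact: wdegree_ge_sum.
have -> : \sum_(x <- N) \sum_(y <- N) G x y * (f x + f y) =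
    \sum_(x <- N) \sum_(y <- N) G x y * f x +
    \sum_(x <- N) \sum_(y <- N) G x y * f x.
  rewrite [X in _ + X]exchange_big -big_split; apply: eq_bigr => x _ /=.
  by rewrite -big_split; apply: eq_bigr => y _ /=; rewrite mulrDr (weight_sym G y).
by rewrite mulr_natl mulr2n lerD.
Qed.

(** The rate for which the chain of estimates in [dissipation_lower_bound] would
    be an equality. *)
Definition dissipation_const p q m d C : R :=
  ((1 - 2^-1 `^ (m * (d - 1) / d)) * 2^-1 `^ ((d - 1) / d) /
   (C * gap_const p q m (m * (d - 1) / d) * 2 `^ ((p - 1) / p))) `^ p.

Lemma half_powR_lt1 (g : R) : 0 < g -> 2^-1 `^ g < 1.
Proof.
move=> g0; have E1 : 1 `^ g = 1 :> R by rewrite powR1.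
by rewrite -[X in _ < X]E1; apply: gt0_ltr_powR => //; rewrite ?nnegrE; lra.
Qed.

Lemma dissipation_const_gt0 p q m d C :
  1 < p -> 0 < q -> 1 < m -> p < d -> 0 < C ->
  0 < dissipation_const p q m d C.
Proof.
move=> p1 q0 m1 pd C0; rewrite powR_gt0// divr_gt0//.
  rewrite mulr_gt0 ?powR_gt0// subr_gt0 half_powR_lt1//.
  by rewrite divr_gt0 ?mulr_gt0//; lra.
rewrite mulr_gt0 ?powR_gt0//; apply: mulr_gt0 => //; exact: gap_const_gt0.
Qed.

(** The Sobolev inequality for [trunc_pow g e] together with [trunc_gap] and
    Hölder's inequality.  The total mass [A] enters through the Hölder factor,
    while the truncated mass only has to exceed a fixed fraction of [A]; the
    exponents are such that the two contributions combine into [1 - p / d]. *)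
Lemma dissipation_lower_bound p q m d C e N (a : V -> R) A :
  1 < p -> 0 < q -> 1 < m -> p < d -> 0 < C ->
  m * p = d * (1 - q * (p - 1)) ->
  isoperimetric G d C -> 0 < e -> uniq N -> 0 < A ->
  (forall x, e < `|a x| -> interior G N x) ->
  \sum_(x <- N) `|a x| `^ m * wdegree G x <= A ->
  A / 2 < \sum_(x <- N) trunc_energy m (2 * e) (a x) * wdegree G x ->
  dissipation_const p q m d C * A `^ (1 - p / d) <= dissipation p q m e N a.
Proof.
move=> p1 q0 m1 pd C0 mE iso e0 uN A0 aN leA ltA.
rewrite leNgt; apply/negP => ltD.
have p0 : 0 < p by lra.
have d1 : 1 < d by lra.
pose g := m * (d - 1) / d.
have g0 : 0 < g by rewrite /g divr_gt0 ?mulr_gt0//; lra.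
pose kappa : R := 1 - 2^-1 `^ g.
have kappa0 : 0 < kappa by rewrite subr_gt0 half_powR_lt1.
have gE : g * p = q * (p - 1) + (m - 1) + m * (p - 1).
  have dn0 : d != 0 by rewrite gt_eqF//; lra.
  have -> : g * p = m * p - m * p / d by rewrite /g; field.
  rewrite {2}mE [X in _ - X](_ : _ = 1 - q * (p - 1)); last by field.
  by ring.
have K1_gt0 : 0 < gap_const p q m g by exact: gap_const_gt0.
have k1 : 0 < d / (d - 1) by rewrite divr_gt0; lra.
set D0 := _ * A `^ _ in ltD.
have D00 : 0 < D0.
  by apply: mulr_gt0; [exact: dissipation_const_gt0|exact: powR_gt0].
(* twice the bound obtained below for [C / 2] times the total variation of
   [trunc_pow], because the bound in [l1_sobolev] is strict *)
pose B := C * gap_const p q m g * (D0 `^ p^-1 * (2 * A) `^ ((p - 1) / p)).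
have A20 : 0 < 2 * A by rewrite mulr_gt0.
have B0 : 0 < B.
  apply: mulr_gt0; first exact: mulr_gt0.
  by apply: mulr_gt0; exact: powR_gt0.
have hoelder : \sum_(x <- N) \sum_(y <- N) G x y *
    `|trunc_pow g e (a x) - trunc_pow g e (a y)| <=
    gap_const p q m g * (D0 `^ p^-1 * (2 * A) `^ ((p - 1) / p)).
  pose s := [seq (x, y) | x <- N, y <- N].
  pose X (z : V * V) := `|spow (a z.1) q - spow (a z.2) q| `^ (p - 1) *
    `|trunc_slope m e (a z.1) - trunc_slope m e (a z.2)|.
  pose Z (z : V * V) := `|a z.1| `^ m + `|a z.2| `^ m.
  have X0 z : 0 <= X z by rewrite mulr_ge0 ?powR_ge0.
  have Z0 z : 0 <= Z z by rewrite addr_ge0 ?powR_ge0.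
  have w0 (z : V * V) : 0 <= G z.1 z.2 by exact: weight_ge0.
  have hX : \sum_(z <- s) G z.1 z.2 * X z <= D0 by rewrite big_allpairs; exact: ltW.
  have hZ : \sum_(z <- s) G z.1 z.2 * Z z <= 2 * A.
    rewrite big_allpairs; apply: (le_trans (@sum_weight_add_le N (fun x => `|a x| `^ m) uN _)).
      by move=> x; exact: powR_ge0.
    by rewrite ler_pM2l.
  have := hoelder_sum w0 p1 X0 Z0 D00 A20 hX hZ.
  rewrite big_allpairs => h.
  apply: le_trans (ler_wpM2l (ltW K1_gt0) h).
  rewrite mulr_sumr; apply: ler_sum => x _; rewrite mulr_sumr; apply: ler_sum => y _.
  by rewrite mulrCA ler_wpM2l ?weight_ge0//; exact: trunc_gap.
have sob : \sum_(x <- N) trunc_pow g e (a x) `^ (d / (d - 1)) * wdegree G x <=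
    B `^ (d / (d - 1)).
  apply: (l1_sobolev iso C0 d1 uN).
  - by move=> x; apply: trunc_pow_ge0 => //; exact: ltW.
  - move=> x; have [h|h _] := leP `|a x| e; last exact: aN.
    by rewrite trunc_pow_small// eqxx.
  apply: (@le_lt_trans _ _ (2^-1 * B)); last lra.
  by rewrite /B mulrCA ler_pM2l ?invr_gt0// -mulrA ler_pM2l.
have : A / 2 < (B / kappa) `^ (d / (d - 1)).
  apply: lt_le_trans ltA _.
  have divE (b : R) : 0 <= b -> (b / kappa) `^ (d / (d - 1)) =
      b `^ (d / (d - 1)) * kappa^-1 `^ (d / (d - 1)).
    by move=> b0; rewrite powRM// invr_ge0 ltW.
  rewrite divE ?(ltW B0)//; apply: le_trans (ler_wpM2r (powR_ge0 _ _) sob).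
  rewrite mulr_suml; apply: ler_sum => x _; rewrite mulrAC.
  rewrite ler_wpM2r ?wdegree_ge0// -divE; last by rewrite trunc_pow_ge0// ltW.
  apply: trunc_energy_half => //.
  by rewrite /g; field; apply/andP; split; lra.
suff -> : B / kappa = (A / 2) `^ ((d - 1) / d).
  have e1 : (d - 1) / d * (d / (d - 1)) = 1 by field; apply/andP; split; lra.
  by rewrite -powRrM e1 powRr1 ?ltxx// divr_ge0// ltW.
rewrite /B /D0 /dissipation_const -/g -/kappa.
set K1 := gap_const _ _ _ _.
have K10 : 0 < K1 by exact: K1_gt0.
set F := kappa * _ / _.
have F0 : 0 < F.
  apply: divr_gt0; apply: mulr_gt0; rewrite ?powR_gt0 ?invr_gt0//.
  exact: mulr_gt0.
rewrite (powRM _ (powR_ge0 _ _) (powR_ge0 _ _)) -!powRrM divff ?gt_eqF//.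
rewrite (powRr1 (ltW F0)) (powRM _ _ (ltW A0))// (powRM _ (ltW A0)) ?invr_ge0//.
have AE : A `^ ((1 - p / d) / p) * A `^ ((p - 1) / p) = A `^ ((d - 1) / d).
  rewrite -powRD; last by apply/implyP => _; rewrite gt_eqF.
  by congr (_ `^ _); field; apply/andP; split; lra.
rewrite -AE /F; field.
by rewrite !gt_eqF ?powR_gt0.
Qed.

End dissipation.

(** * One-variable calculus *)

Section calculus.
Context {R : realType}.
Implicit Types (f g : R -> R) (a b c e m s t x : R).

Lemma powR_maxr_continuous s e : 0 < e ->
  continuous (fun a : R => Num.max a e `^ s).
Proof.
move=> e0 x; apply: (@continuous_comp _ _ _ (fun a : R => Num.max a e) (fun y => y `^ s)).
  by apply: (@continuous_max R R id (cst e)); [exact: cvg_id|exact: cvg_cst].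
apply: differentiable_continuous; rewrite -derivable1_diffP.
by apply: derivable_powR; rewrite in_itv/= andbT lt_max e0 orbT.
Qed.

Lemma trunc_slope_continuous m e : 0 < e -> continuous (trunc_slope m e).
Proof.
move=> e0 x; apply: cvgMr; apply: cvgB; first exact: powR_maxr_continuous.
apply: (@continuous_comp _ _ _ (fun a : R => - a) (fun y => Num.max y e `^ (m - 1))).
  exact: opp_continuous.
exact: powR_maxr_continuous.
Qed.

Lemma is_derive_quotient f x l :
  (forall e, 0 < e -> exists2 k, 0 < k & forall y, y != x -> `|y - x| < k ->
     `|l - (f y - f x) / (y - x)| <= e) ->
  is_derive x 1 f l.
Proof.
move=> h; have cvl : (fun h => h^-1 *: ((f \o shift x) (h *: (1 : R)) - f x)) @ 0^' --> l.
  apply/cvgrPdist_le => e e0; have [k k0 hk] := h e e0.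
  rewrite /dnbhs near_withinE; apply/nbhs_ballP; exists k => // y.
  rewrite /ball /= sub0r normrN => yk y0.
  have := hk (y + x); rewrite addrK -subr_eq0 addrK => /(_ y0 yk).
  by rewrite /shift /= [y *: 1]mulr1 [_ *: _]mulrC.
by apply: DeriveDef; [apply/cvg_ex; exists l|apply: cvg_lim].
Qed.

(** A convex function with a continuous subgradient: the difference quotient
    lies between two values of the subgradient. *)
Lemma is_derive_trunc_energy m e a : 0 < e -> 1 < m ->
  is_derive a 1 (trunc_energy m e) (trunc_slope m e a).
Proof.
move=> e0 m1; apply: is_derive_quotient => k k0.
have /cvgrPdist_le /(_ k k0) := @trunc_slope_continuous m e e0 a.
move=> /nbhs_ballP[l /= l0 hl]; exists l => // y ya yl.
have {hl} := hl y; rewrite /ball /= distrC => /(_ yl).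
have h1 := trunc_energy_subgradient a y e0 m1.
have h2 := trunc_energy_subgradient y a e0 m1.
apply: le_trans.
have mono := @trunc_slope_homo _ m e e0 m1.
set Q := (_ - _) / _.
have QE : trunc_energy m e y - trunc_energy m e a = Q * (y - a).
  by rewrite /Q mulfVK// subr_eq0.
rewrite QE in h1; have {}h2 : Q * (y - a) <= trunc_slope m e y * (y - a) by lra.
have [ay|ya'|ay] := ltgtP a y; last by rewrite ay eqxx in ya.
  have ya0 : 0 < y - a by lra.
  rewrite !ler_pM2r// in h1 h2; have := mono _ _ (ltW ay).
  by rewrite !ler0_norm; lra.
have ya0 : y - a < 0 by lra.
rewrite !ler_nM2r// in h1 h2; have := mono _ _ (ltW ya').
by rewrite !ger0_norm; lra.
Qed.

Lemma C1_halfline_is_derive f : C1_halfline f ->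
  forall t, 0 < t -> is_derive t 1 f (derive1 f t).
Proof.
move=> [g [hg _]] t t0.
suff h : is_derive t 1 f (g t) by rewrite derive1E (@derive_val _ _ _ _ _ _ _ h).
apply: is_derive_quotient => e e0.
have /cvgrPdist_le /(_ e e0) := hg t (ltW t0).
rewrite near_withinE => /nbhs_ballP[k /= k0 hk].
exists (Num.min k t); first by rewrite lt_min k0.
move=> y yt; rewrite lt_min => /andP[yk ytt].
apply: hk; first by rewrite /ball /= distrC.
by split=> //; move: ytt; rewrite ltr_norml; lra.
Qed.

Lemma C1_halfline_continuous f : C1_halfline f ->
  forall a b, 0 <= a -> {within `[a, b], continuous f}.
Proof.
move=> [g [hg _]] a b a0; apply/subspace_continuousP => t.
rewrite /= in_itv/= => /andP[at_ tb]; apply/cvgrPdist_le => e e0.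
have t0 : 0 <= t by lra.
have /cvgrPdist_le /(_ 1 ltr01) := hg t t0.
rewrite near_withinE => /nbhs_ballP[k /= k0 hk]; rewrite near_withinE.
set c := `|g t| + 1; have c0 : 0 < c by rewrite ltr_wpDl.
apply/nbhs_ballP; exists (Num.min k (e / c)) => /=; first by rewrite lt_min k0 divr_gt0.
move=> y; rewrite /ball /= lt_min => /andP[yk ye]; rewrite in_itv/= => /andP[ay yb].
have [->|yt] := eqVneq y t; first by rewrite subrr normr0 ltW.
have y0 : 0 <= y by lra.
have := hk y yk (conj y0 yt); set Q := (_ / _) => hQ.
have Qc : `|Q| <= c.
  have := ler_normB (g t) (g t - Q); rewrite opprB addrCA subrr addr0 /c.
  by lra.
have -> : f t - f y = Q * (t - y).
  rewrite /Q -[t - y]opprB mulrN mulfVK ?opprB// subr_eq0//.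
rewrite normrM; apply: (@le_trans _ _ (c * (e / c))); last first.
  by rewrite mulrCA divff ?mulr1// gt_eqF.
by rewrite ler_pM// ltW.
Qed.

End calculus.

(** * Solutions that are bounded in an l^r norm *)

Section mass.
Context {R : realType} {V : countType}.
Variable G : wgraph R V.
Implicit Types (x y : V) (N F : seq V) (r m e A t : R) (f : V -> R).

(** The total mass is bounded through its finite parts, because all estimates
    below take place on finite sets of vertices. *)
Definition mass_le r f A :=
  forall N, uniq N -> \sum_(x <- N) `|f x| `^ r * wdegree G x <= A.

Lemma lnorm_lty_mass r f : 0 < r -> (lnorm G r f < +oo)%E ->
  exists A, [/\ 0 <= A, lnorm G r f = (A `^ r^-1)%:E & mass_le r f A].
Proof.
move=> r0; rewrite /lnorm; set E := (esum _ _) => Ety.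
have E0 : (0 <= E)%E.
  by apply: esum_ge0 => x _; rewrite lee_fin mulr_ge0 ?powR_ge0 ?wdegree_ge0.
have Efin : E \is a fin_num.
  by rewrite ge0_fin_numE//; apply: lty_poweRy Ety; rewrite invr_neq0 ?gt_eqF.
exists (fine E); split; first exact: fine_ge0.
  by rewrite -[in LHS](fineK Efin) poweR_EFin.
move=> N uN; rewrite -lee_fin fineK// -sumEFin (fsbig_seq _ _ uN).
apply: esum_ge; exists [set` N] => //; split => //; exact: finite_seq.
Qed.

Lemma mass_le_pointwise r f A : 0 < r -> mass_le r f A -> forall x,
  `|f x| <= (A / inf (range (wdegree G))) `^ r^-1.
Proof.
move=> r0 h x; have := h [:: x] isT; rewrite big_seq1 => hx.
have i0 := wgraph_inf_degree_gt0 G.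
have : `|f x| `^ r <= A / inf (range (wdegree G)).
  rewrite ler_pdivlMr//; apply: le_trans hx.
  by rewrite ler_wpM2l ?powR_ge0 ?wdegree_ge_inf.
move=> /(ler_powR2r (_ : 0 <= r^-1) (powR_ge0 _ _)).
by rewrite invr_ge0 ltW// -powRrM divff ?gt_eqF// powRr1// => /(_ isT).
Qed.

(** Every vertex where [`|f x| > e] carries a definite part of the mass, as the
    weighted degrees are bounded below. *)
Lemma mass_le_finite r f A e : 0 < r -> 0 < e -> mass_le r f A ->
  exists S : seq V, forall x, e < `|f x| -> x \in S.
Proof.
move=> r0 e0 h; suff /finite_seqP[S SE] : finite_set [set x | e < `|f x|].
  by exists S => x ex; have : [set x | e < `|f x|] x by []; rewrite SE.
apply: contrapT => inf_; have i0 := wgraph_inf_degree_gt0 G.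
set i := inf _ in i0.
have c0 : 0 < e `^ r * i by rewrite mulr_gt0 ?powR_gt0.
have [s [us es sn]] : exists s : seq V, [/\ uniq s,
    {in s, forall x, e < `|f x|} & (Num.bound (A / (e `^ r * i)) <= size s)%N].
  have [B BS Bn] := infinite_set_fset (Num.bound (A / (e `^ r * i))) inf_.
  by exists (finmap.enum_fset B); split=> //; exact: finmap.fset_uniq.
have A0 : 0 <= A by have := h [::] isT; rewrite big_nil.
have := h s us; apply/negP; rewrite -ltNge.
have := archi_boundP (divr_ge0 A0 (ltW c0)); rewrite ltr_pdivrMr// => /lt_le_trans; apply.
apply: (@le_trans _ _ (\sum_(x <- s) e `^ r * i)).
  rewrite big_const_seq count_predT iter_addr_0 -[leRHS]mulr_natl.
  by rewrite ler_pM2r// ler_nat.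
rewrite big_seq [leRHS]big_seq; apply: ler_sum => x xs.
apply: ler_pM; rewrite ?powR_ge0 ?(ltW i0)//; last exact: wdegree_ge_inf.
by apply: ler_powR2r; rewrite ?(ltW r0) ?(ltW e0)// ltW//; exact: es.
Qed.

Lemma ae_dense (P : R -> Prop) a b : 0 <= a -> a < b ->
  {ae (@lebesgue_measure R), forall t : R, 0 <= t -> P t} ->
  exists2 t, a < t < b & P t.
Proof.
move=> a0 ab [B [mB B0 sB]]; apply: contrapT => h.
have sub : `]a, b[%classic `<=` B.
  move=> t /=; rewrite in_itv/= => tab; apply: sB => /= Pt; apply: h.
  by exists t => //; apply: Pt; lra.
have : (lebesgue_measure (`]a, b[%classic : set R) <= lebesgue_measure B)%E.
  by apply: le_measure => //; rewrite mem_set//; exact: measurable_itv.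
by rewrite B0 lebesgue_measure_itv/= lte_fin ab -EFinD lee_fin; lra.
Qed.

End mass.

Section solutions.
Context {R : realType} {V : countType}.
Variables (G : wgraph R V) (p q r : R) (u0 : V -> R) (u : V -> R -> R).
Hypotheses (p1 : 1 < p) (q0 : 0 < q) (r1 : 1 <= r).
Hypothesis sol : solution G p q r u0 u.
Implicit Types (x y : V) (N F : seq V) (a b e s t T : R).

Lemma solution_dense_mass : exists A : R, forall a b : R, 0 <= a -> a < b ->
  exists2 t, a < t < b & mass_le G r (u ^~ t) A.
Proof.
have r0 : 0 < r by exact: lt_le_trans r1.
have [[_ [M hM]] _ _ _] := sol.
exists (Num.max M 0 `^ r) => a b a0 ab.
have [t tab ht] := ae_dense a0 ab hM; exists t => //.
have := le_lt_trans ht (ltry M) => /(lnorm_lty_mass r0)[A [A0 AE hA]] N uN.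
apply: le_trans (hA N uN) _.
move: ht; rewrite AE lee_fin => ht.
rewrite -[leLHS](powRr1 A0) -(@mulVf _ r) ?gt_eqF// powRrM.
by apply: ler_powR2r; rewrite ?powR_ge0 ?(ltW r0)// le_max ht.
Qed.

Lemma solution_continuous x a b : 0 <= a -> {within `[a, b], continuous (u x)}.
Proof. by have [_ /(_ x) h _ _] := sol; exact: C1_halfline_continuous. Qed.

Lemma solution_is_derive x t : 0 < t ->
  is_derive t 1 (u x) (plaplacian G p (fun y => spow (u y t) q) x).
Proof.
move=> t0; have [_ /(_ x) h /(_ x t t0) <- _] := sol.
exact: C1_halfline_is_derive.
Qed.

(** The l^r bound holds at almost every time only; continuity of [u x] carries the
    resulting pointwise bound to all times. *)
Lemma solution_bounded : exists2 U : R, 0 <= U &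
  forall x t, 0 <= t -> `|u x t| <= U.
Proof.
have r0 : 0 < r by exact: lt_le_trans r1.
have [A hA] := solution_dense_mass.
exists ((A / inf (range (wdegree G))) `^ r^-1); first exact: powR_ge0.
move=> x t t0; set U := _ `^ _; rewrite leNgt; apply/negP => ltU.
have e0 : 0 < `|u x t| - U by rewrite subr_gt0.
have /subspace_continuousP/(_ t) := @solution_continuous x t (t + 1) t0.
rewrite /= in_itv/= lexx lerDl ler01 => /(_ isT) /cvgrPdist_lt /(_ _ e0).
rewrite near_withinE => /nbhs_ballP[k /= k0 hk].
have tk : t < t + Num.min k 1 by rewrite ltrDl lt_min k0 ltr01.
have [s /andP[ts st] hs] := hA _ _ t0 tk.
have [sk s1] : s < t + k /\ s < t + 1.
  by split; apply: lt_le_trans st _; rewrite lerD2l ge_min lexx ?orbT.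
have us : `|u x s| <= U by have := mass_le_pointwise r0 hs x.
have bs : `|t - s| < k by rewrite ltr0_norm; lra.
have := hk s bs; rewrite in_itv/= => /(_ _); rewrite (ltW ts) (ltW s1) => /(_ isT).
by have := ler_normB (u x t - u x s) (- u x s); rewrite opprK subrK normrN; lra.
Qed.

Lemma plaplacian_bounded (v : V -> R) (L : R) x : (forall y, `|v y| <= L) ->
  `|plaplacian G p v x| <= (2 * L) `^ (p - 1).
Proof.
move=> vL; have [N uN /(_ x (mem_head _ _)) xN] := finite_interior G [:: x].
have w0 := wdegree_gt0 G x.
rewrite -(ler_pM2l w0) -{1}(gtr0_norm w0) -normrM (plaplacian_interior _ _ uN xN).
apply: le_trans (ler_norm_sum _ _ _) _.
rewrite (wdegreeE uN (proj2 xN)) mulr_suml; apply: ler_sum => y _.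
rewrite mulrC 2!normrM (ger0_norm (weight_ge0 G x y)) ler_wpM2l ?weight_ge0//.
rewrite ger0_norm ?powR_ge0//.
have -> : p - 2 = (p - 1) - 1 by lra.
rewrite mulrC mulr_powRB1// ?subr_gt0//; apply: ler_powR2r => //; first by rewrite subr_ge0 ltW.
apply: le_trans (ler_normB _ _) _; have := vL y; have := vL x; lra.
Qed.

Lemma solution_lipschitz : exists2 L : R, 0 < L &
  forall x s t, 0 <= s -> s <= t -> `|u x t - u x s| <= L * (t - s).
Proof.
have [U U0 hU] := solution_bounded.
exists ((2 * U `^ q) `^ (p - 1) + 1); first by rewrite ltr_wpDl ?powR_ge0.
move=> x s t s0 st.
have der c : c \in `]s, t[ ->
    is_derive c 1 (u x) (plaplacian G p (fun y => spow (u y c) q) x).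
  rewrite in_itv/= => /andP[sc _]; apply: solution_is_derive.
  exact: le_lt_trans sc.
have [c] := MVT_segment st der (@solution_continuous x s t s0).
have ts : 0 <= t - s by rewrite subr_ge0.
rewrite in_itv/= => /andP[sc ct] ->; rewrite normrM (ger0_norm ts).
rewrite ler_wpM2r//; apply: ler_wpDr => //.
apply: plaplacian_bounded => y; rewrite norm_spow//.
by apply: ler_powR2r; [exact: ltW|exact: normr_ge0|apply: hU; lra].
Qed.

(** Equicontinuity in time reduces a bounded time interval to finitely many
    times, at each of which only finitely many vertices are above [e / 2]. *)
Lemma solution_finite_support (e T : R) : 0 < e ->
  exists S : seq V, forall x t, 0 <= t <= T -> e < `|u x t| -> x \in S.
Proof.
move=> e0; have [L L0 hL] := solution_lipschitz.
have [A hA] := solution_dense_mass.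
have r0 : 0 < r by exact: lt_le_trans r1.
pose k := e / (2 * L).
have k0 : 0 < k by rewrite divr_gt0// mulr_gt0.
have Lk : L * k = e / 2 by rewrite /k; field; rewrite gt_eqF.
have local a : 0 <= a -> exists S : seq V,
    forall x t, a <= t <= a + k -> e < `|u x t| -> x \in S.
  move=> a0; have ak : a < a + k by lra.
  have [s /andP[as_ sa] hs] := hA a (a + k) a0 ak.
  have e20 : 0 < e / 2 by rewrite divr_gt0.
  have [S hS] := mass_le_finite r0 e20 hs.
  exists S => x t /andP[at_ ta] ex; apply: hS.
  have lip : `|u x t - u x s| <= L * k.
    have [ts|st] := leP t s.
      rewrite distrC; apply: le_trans (hL x t s _ ts) _; first lra.
      by rewrite ler_pM2l//; lra.
    apply: le_trans (hL x s t _ (ltW st)) _; first lra.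
    by rewrite ler_pM2l//; lra.
  have := ler_normD (u x t - u x s) (u x s); rewrite subrK; lra.
have main n : exists S : seq V, forall x t, 0 <= t <= n%:R * k ->
    e < `|u x t| -> x \in S.
  elim: n => [|n [S hS]].
    have [S hS] := local 0 (lexx _).
    by exists S => x t /andP[t0 tk]; apply: hS; lra.
  have [S' hS'] := local (n%:R * k) (mulr_ge0 (ler0n _ _) (ltW k0)).
  exists (S ++ S') => x t /andP[t0 tk] ex; rewrite mem_cat.
  have [tn|nt] := leP t (n%:R * k); first by rewrite (hS x t) ?t0.
  rewrite (hS' x t) ?orbT// (ltW nt)/=.
  by move: tk; rewrite -natr1 mulrDl mul1r.
have [S hS] := main (Num.bound (T / k)); exists S => x t /andP[t0 tT].
apply: hS; rewrite t0 (le_trans tT)//.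
have [T0|T0] := leP 0 T; last by rewrite (le_trans (ltW T0))// mulr_ge0// ltW.
by rewrite -ler_pdivrMr// ltW// archi_boundP// divr_ge0// ltW.
Qed.

End solutions.

(** * Decay of the mass *)

Section finite_sum_calculus.
Context {R : realType} {I : Type}.
Implicit Types (N : seq I) (h : I -> R -> R).

Lemma is_derive_seq_sum N h (dh : I -> R) (t : R) :
  (forall i, is_derive t 1 (h i) (dh i)) ->
  is_derive t 1 (fun s => \sum_(i <- N) h i s) (\sum_(i <- N) dh i).
Proof.
move=> hh; elim: N => [|i N IH].
  rewrite big_nil [X in is_derive _ _ X](_ : _ = cst 0); first exact: is_derive_cst.
  by apply/funext => s; rewrite big_nil.
rewrite big_cons [X in is_derive _ _ X](_ : _ = h i + (fun s => \sum_(i <- N) h i s)).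
  exact: is_deriveD.
by apply/funext => s; rewrite big_cons.
Qed.

Lemma within_continuous_seq_sum N h (A : set R) :
  (forall i, {within A, continuous (h i)}) ->
  {within A, continuous (fun s => \sum_(i <- N) h i s)}.
Proof.
move=> hh; apply/subspace_continuousP => t At; elim: N => [|i N IH].
  rewrite (_ : (fun s => _) = cst 0); first exact: cvg_cst.
  by apply/funext => s; rewrite big_nil.
rewrite (_ : (fun s => _) = h i + (fun s => \sum_(i <- N) h i s)).
  by apply: cvgD => //; move/subspace_continuousP: (hh i); exact.
by apply/funext => s; rewrite big_cons.
Qed.

End finite_sum_calculus.

Section decay.
Context {R : realType} {V : countType}.
Variables (G : wgraph R V) (p q r m : R) (u0 : V -> R) (u : V -> R -> R).
Hypotheses (p1 : 1 < p) (q0 : 0 < q) (r1 : 1 <= r) (m1 : 1 < m).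
Hypothesis sol : solution G p q r u0 u.
Implicit Types (x y : V) (N F : seq V) (a b e s t T A : R).

Definition energy e N t : R :=
  \sum_(x <- N) trunc_energy m e (u x t) * wdegree G x.

(** During [[s, t]], sums of quantities truncated at level [e] are sums over [N],
    including the contributions of the neighbours. *)
Definition covering N e s t :=
  forall x c, s <= c <= t -> e < `|u x c| -> interior G N x.

Lemma energy_ge0 e N t : 0 < e -> 0 <= energy e N t.
Proof.
move=> e0; rewrite sumr_ge0// => x _.
by rewrite mulr_ge0 ?wdegree_ge0// trunc_energy_ge0.
Qed.

Lemma energy_subset e F N t : 0 < e -> uniq F -> uniq N -> {subset F <= N} ->
  energy e F t <= energy e N t.
Proof.
move=> e0 uF uN FN; rewrite /energy.
rewrite [leRHS](bigID (fun x => x \in F)) /= -[leLHS]addr0 lerD//; last first.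
  rewrite sumr_ge0// => x _.
  by rewrite mulr_ge0 ?wdegree_ge0// trunc_energy_ge0.
rewrite -[leRHS]big_filter le_eqVlt; apply/orP; left; apply/eqP/perm_big.
apply: uniq_perm; rewrite ?filter_uniq// => x; rewrite mem_filter.
by case: (boolP (x \in F)) => //= /FN ->.
Qed.

Lemma exists_covering F e s t : 0 < e -> 0 <= s ->
  exists N, [/\ uniq N, {subset F <= N} & covering N e s t].
Proof.
move=> e0 s0; have [S hS] := solution_finite_support p1 q0 r1 sol t e0.
have [N uN hN] := finite_interior G (F ++ S); exists N; split=> //.
  by move=> x xF; have [] : interior G N x by apply: hN; rewrite mem_cat xF.
move=> x c /andP[sc ct] ex; apply: hN; rewrite mem_cat (hS x c) ?orbT//.
by rewrite (le_trans s0 sc).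
Qed.

Lemma covering_sub N e e' s s' t t' : e <= e' -> s <= s' -> t' <= t ->
  covering N e s t -> covering N e' s' t'.
Proof.
move=> ee ss tt h x c /andP[sc ct] ex; apply: (h x c); last exact: le_lt_trans ex.
by rewrite (le_trans ss sc) (le_trans ct tt).
Qed.

(** The mean value theorem for the truncated energy, whose time derivative is
    computed by Green's formula. *)
Lemma energy_mvt e N s t : 0 < e -> 0 <= s -> s < t -> uniq N ->
  covering N e s t ->
  exists2 c, s < c < t & energy e N t - energy e N s =
    - (2^-1 * dissipation G p q m e N (u ^~ c)) * (t - s).
Proof.
move=> e0 s0 st uN cov.
pose h x c := wdegree G x * trunc_energy m e (u x c).
pose v c y := spow (u y c) q.
pose dh c x := wdegree G x * (trunc_slope m e (u x c) * plaplacian G p (v c) x).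
have hE c : energy e N c = \sum_(x <- N) h x c.
  by apply: eq_bigr => x _; rewrite mulrC.
have der c : c \in `]s, t[ ->
    is_derive c 1 (fun c => \sum_(x <- N) h x c) (\sum_(x <- N) dh c x).
  rewrite in_itv/= => /andP[sc _]; apply: is_derive_seq_sum => x.
  apply: (@is_deriveZ _ _ _ (trunc_energy m e \o u x) (wdegree G x)).
  apply: is_derive1_comp; first exact: is_derive_trunc_energy.
  exact: (solution_is_derive sol x (le_lt_trans s0 sc)).
have cont : {within `[s, t], continuous (fun c => \sum_(x <- N) h x c)}.
  apply: within_continuous_seq_sum => x; apply/subspace_continuousP => c cst.
  apply: cvgM; first exact: cvg_cst.
  have /subspace_continuousP/(_ c cst) := @solution_continuous _ _ _ _ _ _ _ _ sol x s t s0.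
  apply: continuous_cvg; apply: differentiable_continuous.
  rewrite -derivable1_diffP.
  by have [] := is_derive_trunc_energy (u x c) e0 m1.
have [c] := MVT st der cont; rewrite in_itv/= => cst; rewrite -!hE => ->.
exists c => //; congr (_ * _); rewrite /dh.
apply: (green_comonotone uN p1 (f := fun x => trunc_slope m e (u x c))).
- move=> x; have [h0|h0 _] := leP `|u x c| e.
    by rewrite trunc_slope_small// eqxx.
  by apply: (cov x c) => //; case/andP: cst => *; rewrite !ltW.
- move=> x y; have [xy|/ltW yx] := leP (u x c) (u y c).
    by rewrite mulr_ge0// subr_ge0; [exact: trunc_slope_homo|exact: spow_homo].
  by rewrite mulr_le0// subr_le0; [exact: trunc_slope_homo|exact: spow_homo].
Qed.

Lemma energy_nonincreasing e N s t : 0 < e -> 0 <= s -> s <= t -> uniq N ->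
  covering N e s t -> energy e N t <= energy e N s.
Proof.
move=> e0 s0; rewrite le_eqVlt => /predU1P[->//|st] uN cov.
have [c _ E] := energy_mvt e0 s0 st uN cov.
rewrite -subr_le0 E mulNr oppr_le0 mulr_ge0 ?subr_ge0 ?(ltW st)//.
by rewrite mulr_ge0 ?dissipation_ge0 ?invr_ge0.
Qed.

Lemma energy_le_mass e N t A : 0 < e -> uniq N -> mass_le G m (u ^~ t) A ->
  energy e N t <= A.
Proof.
move=> e0 uN h; apply: le_trans (h N uN); apply: ler_sum => x _.
by rewrite ler_wpM2r ?wdegree_ge0// trunc_energy_le.
Qed.

(** The truncation error is at most [m * e `^ (m - 1)] times the weighted sum of
    [`|u|] over [F], so it vanishes with [e]. *)
Lemma mass_near_energy F t (k : R) : 0 < k -> exists e, [/\ 0 < e &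
  \sum_(x <- F) `|u x t| `^ m * wdegree G x < energy e F t + k].
Proof.
move=> k0; set Z := \sum_(x <- F) `|u x t| * wdegree G x.
have Z0 : 0 <= Z by rewrite sumr_ge0// => x _; rewrite mulr_ge0 ?wdegree_ge0.
have m0 : 0 < m by exact: lt_trans m1.
have c0 : 0 < m * (Z + 1) by rewrite mulr_gt0// ltr_wpDl.
have m10 : 0 < m - 1 by rewrite subr_gt0.
pose e := (k / (m * (Z + 1))) `^ (m - 1)^-1.
have e0 : 0 < e by rewrite powR_gt0// divr_gt0.
exists e; split => //.
have eE : e `^ (m - 1) = k / (m * (Z + 1)).
  by rewrite /e -powRrM mulVf ?gt_eqF// powRr1// divr_ge0 ?ltW.
apply: (@le_lt_trans _ _ (energy e F t + m * e `^ (m - 1) * Z)).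
  rewrite /energy /Z mulr_sumr -big_split; apply: ler_sum => x _ /=.
  by rewrite mulrA -mulrDl ler_wpM2r ?wdegree_ge0// norm_powR_le_trunc_energy.
rewrite ltrD2l eE; have -> : m * (k / (m * (Z + 1))) * Z = k * (Z / (Z + 1)).
  by field; rewrite !gt_eqF// ltr_wpDl.
rewrite -[ltRHS]mulr1 ltr_pM2l// ltr_pdivrMr ?mul1r; last by rewrite ltr_wpDl.
by rewrite ltrDl.
Qed.

(** The limit [e -> 0] of [energy_nonincreasing], taken on one finite set of
    vertices at a time. *)
Lemma mass_le_nonincreasing s t A : 0 <= s -> s <= t ->
  mass_le G m (u ^~ s) A -> mass_le G m (u ^~ t) A.
Proof.
move=> s0 st h F uF; rewrite leNgt; apply/negP => ltA.
have k0 : 0 < \sum_(x <- F) `|u x t| `^ m * wdegree G x - A by rewrite subr_gt0.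
have [e [e0]] := mass_near_energy F t k0.
have [N [uN FN cov]] := exists_covering F t e0 s0.
have h1 := energy_subset t e0 uF uN FN.
have h2 := energy_nonincreasing e0 s0 st uN cov.
have h3 := energy_le_mass e0 uN h; lra.
Qed.

(** If the mass stayed above [A / 2] on the whole interval, the truncated energy
    would decrease at half the rate of [dissipation_lower_bound].  The factor 4
    makes this a loss of [2 * A], although the energy starts at most at [A]. *)
Lemma mass_halves d C s A : p < d -> 0 < C -> m * p = d * (1 - q * (p - 1)) ->
  isoperimetric G d C -> 0 <= s -> 0 <= A ->
  mass_le G m (u ^~ s) A ->
  mass_le G m (u ^~ (s + 4 / dissipation_const p q m d C * A `^ (p / d))) (A / 2).
Proof.
move=> pd C0 mE iso s0 A0 h; set K := dissipation_const p q m d C; set t := s + _.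
have K0 : 0 < K by exact: dissipation_const_gt0.
have st : s <= t by rewrite lerDl mulr_ge0 ?powR_ge0 ?divr_ge0// ltW.
have ht := mass_le_nonincreasing s0 st h.
move: A0; rewrite le_eqVlt => /predU1P[A0|A0]; first by rewrite -A0 mul0r A0.
have {}st : s < t by rewrite ltrDl mulr_gt0 ?powR_gt0 ?divr_gt0.
move=> F uF; rewrite leNgt; apply/negP => ltA.
have k0 : 0 < \sum_(x <- F) `|u x t| `^ m * wdegree G x - A / 2 by rewrite subr_gt0.
have [e2 [e20 he2]] := mass_near_energy F t k0.
pose e := e2 / 2; have e0 : 0 < e by rewrite divr_gt0.
have eE : e2 = 2 * e by rewrite /e; field.
have [N [uN FN cov]] := exists_covering F t e0 s0.
have [c /andP[sc ct] E] := energy_mvt e0 s0 st uN cov.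
(* at every earlier time, the energy truncated at [2 * e] is at least as large
   as at time [t] *)
have ltE : A / 2 < energy (2 * e) N c.
  have h1 := energy_subset t e20 uF uN FN.
  have cov2 : covering N e2 c t.
    by apply: covering_sub cov; rewrite ?(ltW sc)// eE; lra.
  have h2 := energy_nonincreasing e20 (le_trans s0 (ltW sc)) (ltW ct) uN cov2.
  by rewrite -eE; lra.
have cN x : e < `|u x c| -> interior G N x by apply: cov; rewrite !ltW.
have hc := mass_le_nonincreasing s0 (ltW sc) h.
have := dissipation_lower_bound p1 q0 m1 pd C0 mE iso e0 uN A0 cN (hc N uN) ltE.
rewrite -/K => low.
have tE : K * A `^ (1 - p / d) * (t - s) = 4 * A.
  rewrite /t addrAC subrr add0r; have -> : K * A `^ (1 - p / d) * (4 / K * A `^ (p / d)) =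
    4 * (A `^ (1 - p / d) * A `^ (p / d)) by field; rewrite gt_eqF.
  rewrite -powRD; last by apply/implyP => _; rewrite gt_eqF.
  by rewrite subrK powRr1// ltW.
have ts : 0 <= t - s by rewrite subr_ge0 ltW.
have := ler_wpM2r ts low; rewrite tE => drop.
have h1 := energy_ge0 N t e0.
have h2 := energy_le_mass e0 uN h.
by move: E; rewrite mulNr -mulrA; lra.
Qed.

End decay.

(** * Extinction *)

Section extinction.
Context {R : realType} {V : countType}.
Implicit Types (G : wgraph R V).

Lemma isoperimetric_le G (d C C' : R) : C <= C' ->
  isoperimetric G d C -> isoperimetric G d C'.
Proof.
move=> CC iso W finW; apply: le_trans (iso W finW) _.
by rewrite ler_wpM2r// fsumr_ge0// => e _; exact: weight_ge0.
Qed.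

(** The sum of the geometric series of halving times, per unit of
    [A `^ (p / d)]. *)
Definition extinction_const (p q m d C : R) : R :=
  4 / dissipation_const p q m d C / (1 - 2^-1 `^ (p / d)).

(** The [k]-th halving takes a time proportional to [(A / 2 ^+ k) `^ (p / d)], so
    the halving times form a convergent geometric series. *)
Lemma solution_extinct G (p q m d C r A t : R) u0 (u : V -> R -> R) :
  1 < p -> 0 < q -> 1 < m -> p < d -> 0 < C -> m * p = d * (1 - q * (p - 1)) ->
  isoperimetric G d C -> 1 <= r -> solution G p q r u0 u ->
  0 <= A -> mass_le G m u0 A ->
  extinction_const p q m d C * A `^ (p / d) <= t ->
  forall x, u x t = 0.
Proof.
move=> p1 q0 m1 pd C0 mE iso r1 sol A0 hA ht x.
have pd0 : 0 < p / d by rewrite divr_gt0; lra.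
have K0 : 0 < dissipation_const p q m d C by exact: dissipation_const_gt0.
set rho : R := 2^-1 `^ (p / d).
have rho0 : 0 < rho by rewrite powR_gt0// invr_gt0.
have rho1 : rho < 1 by exact: half_powR_lt1.
set T := extinction_const p q m d C in ht.
have TE : T * (1 - rho) = 4 / dissipation_const p q m d C.
  by rewrite /T /extinction_const mulfVK// subr_eq0 gt_eqF.
have T0 : 0 <= T by rewrite -(@pmulr_lge0 _ (1 - rho)) ?subr_gt0// TE divr_ge0// ltW.
have TA0 : 0 <= T * A `^ (p / d) by rewrite mulr_ge0 ?powR_ge0.
pose tk k := T * A `^ (p / d) * (1 - rho ^+ k).
have tk0 k : 0 <= tk k by rewrite mulr_ge0// subr_ge0 exprn_ile1 ?ltW.
have hk k : mass_le G m (u ^~ (tk k)) (A / 2 ^+ k).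
  elim: k => [|k IH].
    rewrite /tk expr0 subrr mulr0 divr1; have [_ _ _ u00] := sol.
    by rewrite (_ : u ^~ 0 = u0)//; apply/funext.
  have Ak0 : 0 <= A / 2 ^+ k by rewrite divr_ge0// exprn_ge0.
  have := mass_halves p1 q0 r1 m1 sol pd C0 mE iso (tk0 k) Ak0 IH.
  have -> : A / 2 ^+ k / 2 = A / 2 ^+ k.+1 by rewrite exprSr invfM; ring.
  suff -> : tk k + 4 / dissipation_const p q m d C * (A / 2 ^+ k) `^ (p / d) = tk k.+1.
    by [].
  have -> : (A / 2 ^+ k) `^ (p / d) = A `^ (p / d) * rho ^+ k.
    rewrite powRM ?invr_ge0 ?exprn_ge0//; congr (_ * _).
    by rewrite /rho -powR_mulrn ?powR_ge0// powRAC powR_mulrn ?invr_ge0// exprVn.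
  by rewrite -TE /tk exprSr; ring.
have tkt k : tk k <= t.
  by apply: le_trans ht; rewrite /tk ler_piMr// gerBl exprn_ge0// ltW.
have ut k : `|u x t| `^ m * wdegree G x <= A / 2 ^+ k.
  have := mass_le_nonincreasing p1 q0 r1 m1 sol (tk0 k) (tkt k) (hk k).
  by move=> /(_ [:: x] isT); rewrite big_seq1.
set X := _ * _ in ut.
have X0 : X <= 0.
  rewrite leNgt; apply/negP => X0.
  have := archi_boundP (divr_ge0 A0 (ltW X0)); set n := Num.bound _.
  rewrite ltr_pdivrMr// => ltA.
  have := ut n; rewrite ler_pdivlMr ?exprn_gt0// leNgt => /negP; apply.
  apply: (lt_le_trans ltA); rewrite mulrC ler_wpM2l ?(ltW X0)//.
  by rewrite -natrX ler_nat ltnW// ltn_expl.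
have : X == 0 by rewrite eq_le X0 mulr_ge0 ?powR_ge0 ?wdegree_ge0.
rewrite mulf_eq0 (gt_eqF (wdegree_gt0 G x)) orbF powR_eq0 normr_eq0.
by case/andP => /eqP.
Qed.

End extinction.

Theorem theorem1p9 (R : realType) (p q d Cd : R)
    (hp : 1 < p) (hq : 0 < q) (hd : p < d) (hpq : q * (p - 1) < (d - p) / d) :
  let m := d * (1 - q * (p - 1)) / p in
  1 < m /\
  exists2 C : R, 0 < C &
    forall (V : countType) (G : wgraph R V), isoperimetric G d Cd ->
    forall (r : R) (u0 : V -> R) (u : V -> R -> R),
      1 <= r -> in_lr G m u0 -> solution G p q r u0 u ->
      let extinct := forall t : R, 0 <= t ->
        (C%:E * lnorm G m u0 `^ (m * p / d) <= t%:E)%E ->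
        forall x : V, u x t = 0 in
      (1 < q -> extinct) /\
      (forall x0 : V, exhaustion_solution G p q r u0 x0 u -> extinct).
Proof.
have p0 : 0 < p by lra.
have d0 : 0 < d by lra.
move=> m; have mE : m * p = d * (1 - q * (p - 1)) by rewrite /m mulfVK// gt_eqF.
have m1 : 1 < m.
  move: hpq; rewrite ltr_pdivlMr// /m => h.
  by rewrite ltr_pdivlMr// mul1r; lra.
split=> //.
have C0 : 0 < `|Cd| + 1 by rewrite ltr_wpDl.
exists (extinction_const p q m d (`|Cd| + 1)).
  rewrite divr_gt0 ?subr_gt0 ?half_powR_lt1 ?divr_gt0//.
  exact: dissipation_const_gt0.
move=> V G iso r u0 u r1 u0m sol extinct.
have CdC : Cd <= `|Cd| + 1 by apply: le_trans (ler_norm _) _; rewrite lerDl.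
have ext : extinct.
  have [A [A0 AE hA]] := lnorm_lty_mass (lt_trans ltr01 m1) u0m.
  move=> t _ ht; move: ht; rewrite AE poweR_EFin -EFinM lee_fin -powRrM.
  have -> : m^-1 * (m * p / d) = p / d by field; rewrite !gt_eqF//; lra.
  exact: (solution_extinct hp hq m1 hd C0 mE (isoperimetric_le CdC iso) r1 sol A0 hA).
by split=> // x0 _; exact: ext.
Qed.
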